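(* Let $A,K>0$ and $0<\theta<1$. For every $j\ge1$ select $n_j$ randomly and uniformly from the interval $\bigl(j/A-Kj^\theta,\ j/A+Kj^\theta\bigr]\cap\mathbb{R}_{>0}$, independently for different $j$. Then the counting function of $\mathcal{N}=(n_j)_{j\ge1}$ satisfies $N(x)=Ax+O(x^\theta)$, and with probability $1$ there is a constant $C$ such that for all $x\ge1$ and all $t\in\mathbb{R}$, $$\Bigl|\sum_{n_j\le x}n_j^{-\mathrm{i} t}-A\frac{x^{1-\mathrm{i} t}}{1-\mathrm{i} t}\Bigr|\le C\Bigl(\sqrt{x}\bigl(\sqrt{\log(x+1)}+\sqrt{\log(|t|+1)}\bigr)+x^\theta+x^{1-\theta}\Bigr).$$ In particular, when $\theta=1/2$, $\mathrm{LH}(\mathcal{N},Ax)$ holds with probability $1$.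
   Context: $N(x)=\#\{j:n_j\le x\}$ (the sequence need not be monotone). $\mathrm{LH}(\mathcal{N},M(x))$ for differentiable $M$ means: for every $\varepsilon>0$ and $B>0$ there is $C'=C'(\varepsilon,B)$ with $\bigl|\sum_{n_j\le x}n_j^{-\mathrm{i} t}-\int_{n_1}^x u^{-\mathrm{i} t}M'(u)\,\mathrm{d}u\bigr|\le C' M(x)^{1/2}|t|^{\varepsilon}$ for all real $t$ and $n_1\le x\le|t|^B$. *)

(* Defs.v *)
From HB Require Import structures.
From mathcomp Require Import all_boot all_order all_algebra.
From mathcomp Require Import finmap.
From mathcomp Require Import all_classical all_reals all_analysis.
From mathcomp Require Export complex.

Set Implicit Arguments.
Unset Strict Implicit.
Unset Printing Implicit Defensive.

Import Order.TTheory GRing.Theory Num.Theory.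
Import numFieldNormedType.Exports.

Local Open Scope classical_set_scope.
Local Open Scope ring_scope.
Local Open Scope complex_scope.

(* x ^ s = exp (s * ln x) with the real logarithm; meaningful for 0 < x. *)
Definition cpowR (R : realType) (x : R) (s : R[i]) : R[i] :=
  (expR (complex.Re s * ln x))%:C *
  (cos (complex.Im s * ln x) +i* sin (complex.Im s * ln x)).

(* Lebesgue integral over [a, b], so meaningful for a <= b. *)
Definition Cintegral (R : realType) (a b : R) (f : R -> R[i]) : R[i] :=
  Rintegral (@lebesgue_measure R) `[a, b] (fun u => complex.Re (f u)) +i*
  Rintegral (@lebesgue_measure R) `[a, b] (fun u => complex.Im (f u)).

Section Sequences.
Context {R : realType}.
Implicit Types (s : nat -> R) (x t : R).

(* A sequence (n_j), j >= 1, is a function s on nat whose value at 0 is never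
   used. *)
Definition indices_le s x : set nat := [set j | (0 < j)%N /\ s j <= x].

(* [counting_fun] and [power_sum] are junk when [indices_le s x] is infinite. *)
Definition counting_fun s x : nat := #|` fset_set (indices_le s x)|.

Definition power_sum s x t : R[i] :=
  \sum_(j \in indices_le s x) cpowR (s j) (0 -i* t).

Definition LH s (M : R -> R) : Prop :=
  forall eps B : R, 0 < eps -> 0 < B -> exists C : R,
    forall t x, s 1%N <= x -> x <= `|t| `^ B ->
      Normc.normc (power_sum s x t
        - Cintegral (s 1%N) x
            (fun u => cpowR u (0 -i* t) * (derive1 M u)%:C))
      <= C * Num.sqrt (M x) * `|t| `^ eps.

End Sequences.

Section Selection.
Context {R : realType}.
Variables (A K theta : R) (j : nat).

Definition sel_lo : R := Num.max 0 (j%:R / A - K * j%:R `^ theta).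
Definition sel_hi : R := j%:R / A + K * j%:R `^ theta.

Lemma sel_itvE :
  `]j%:R / A - K * j%:R `^ theta, j%:R / A + K * j%:R `^ theta]%classic
    `&` [set y : R | 0 < y] = `]sel_lo, sel_hi]%classic :> set R.
Proof.
apply/seteqP; split=> y /=; rewrite !in_itv /= gt_max.
  by move=> [/andP[-> ->] ->].
by move=> /andP[/andP[-> ->] ->].
Qed.

Lemma sel_lt : 0 < A -> 0 < K -> (0 < j)%N -> sel_lo < sel_hi.
Proof.
move=> A0 K0 j0; have J0 : (0 : R) < j%:R by rewrite ltr0n.
have a0 : 0 < j%:R / A by rewrite divr_gt0.
have b0 : 0 < K * j%:R `^ theta by rewrite mulr_gt0// powR_gt0.
rewrite /sel_lo /sel_hi gt_max addr_gt0//=.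
by rewrite ltrD2l gtrN.
Qed.

End Selection.

Section RandomVariables.
Context {R : realType} {d : measure_display} {T : measurableType d}.
Variable P : probability T R.

(* The library's uniform law lives on [a, b]; the first clause confines the
   values themselves to the half-open interval. *)
Definition uniformly_selected (X : {RV P >-> R}) (a b : R) (ab : a < b) : Prop :=
  (forall w : T, `]a, b]%classic (X w)) /\
  (forall B : set R, measurable B -> distribution P X B = uniform_prob ab B).

Definition mutually_independent (I : choiceType) (J : set I)
    (X : I -> {RV P >-> R}) : Prop :=
  forall (F : {fset I}) (B : I -> set R), [set` F] `<=` J ->
    (forall i, i \in F -> measurable (B i)) ->
    P (\bigcap_(i in [set` F]) (X i @^-1` B i)) =
    (\prod_(i <- F) P (X i @^-1` B i))%E.

End RandomVariables.

(* Main.v *)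
(* Through its real and imaginary parts, u ^ (- i t) becomes cos (t ln u + phi)
   with phi = 0 and phi = pi / 2.  Every n_j lies within O(j ^ theta) of j / A,
   so that {j | n_j <= x} differs from [1, A x] by O(x ^ theta) indices; this
   gives the counting function and allows one to sum over j <= A x instead.

   The mean of the j-th term is the slope S(j) of the secant of the first
   antiderivative of the oscillating function over the j-th window.  Uniformly
   in t, S' = O(y ^ (- theta)), and A times the secant slope of the second
   antiderivative has derivative S + O(y ^ (theta - 1)).  Telescoping gives
   A x ^ (1 - i t) / (1 - i t) + O(x ^ theta + x ^ (1 - theta)) for the sum of
   the means.

   The centred terms are independent and bounded, so that their sum over j <= N
   is sub-Gaussian with variance O(N).  On the grid t = m / N, a deviation of
   order sqrt (N (ln (N + 1) + ln (m + 1))) has probability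
   O(N ^ (-2) m ^ (-2)), which is summable, and the Borel-Cantelli lemma
   applies; the sum is Lipschitz in t with constant O(N ^ (3 / 2)), hence the
   bound extends to all t. *)

Require Import Defs.
From HB Require Import structures.
From mathcomp Require Import all_boot all_order all_algebra.
From mathcomp Require Import finmap.
From mathcomp Require Import all_classical all_reals all_analysis.
From mathcomp Require Import measurable_realfun ring lra.

Set Implicit Arguments.
Unset Strict Implicit.
Unset Printing Implicit Defensive.

Import Order.TTheory GRing.Theory Num.Theory.
Import numFieldNormedType.Exports.

Local Open Scope classical_set_scope.
Local Open Scope ring_scope.
Local Open Scope complex_scope.

Section MeanValue.
Context {R : realType}.
Implicit Types (f df F G : R -> R) (a b u v : R).

Lemma MVT_is_derive f df a b : a <= b ->
  (forall x, a <= x <= b -> is_derive x 1 f (df x)) ->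
  exists2 c, a <= c <= b & f b - f a = df c * (b - a).
Proof.
move=> ab fd; have [||c] := @MVT_segment R f df a b ab.
- by move=> x; rewrite in_itv/= => /andP[ax xb]; apply: fd; rewrite !ltW.
- apply: derivable_within_continuous => x; rewrite in_itv/= => xab.
  exact: (@ex_derive _ _ _ _ _ _ _ (fd x xab)).
- by rewrite in_itv/= => cab E; exists c.
Qed.

Lemma is_derive_dist_le (i : interval R) f df M :
  (forall x, x \in i -> is_derive x 1 f (df x)) ->
  (forall x, x \in i -> `|df x| <= M) ->
  {in i &, forall u v, `|f u - f v| <= M * `|u - v|}.
Proof.
move=> fd fM u v; wlog uv : u v / u <= v.
  move=> le_case ui vi; have [/le_case|/ltW/le_case] := leP u v; first exact.
  by rewrite distrC (distrC u); apply.
move=> ui vi; have uvi x : u <= x <= v -> x \in i.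
  exact: (@interval_is_interval _ i u v).
have [x /uvi|c /uvi ci E] := @MVT_is_derive f df _ _ uv; first exact: fd.
by rewrite distrC E normrM (distrC u) ler_wpM2r// fM.
Qed.

Lemma cos_dist_le u v : `|cos u - cos v| <= `|u - v|.
Proof.
rewrite -[leRHS]mul1r.
apply: (@is_derive_dist_le `]-oo, +oo[ _ (fun x => - sin x)); rewrite ?in_itv//.
by move=> x _; rewrite normrN sin_max.
Qed.

Definition unit_primitives f F G : Prop :=
  [/\ forall u, 0 < u -> `|f u| <= 1, forall u, 0 < u -> `|F u| <= u,
      forall u, 0 < u -> is_derive u 1 F (f u) &
      forall u, 0 < u -> is_derive u 1 G (F u)].

Lemma unit_primitives_dist_le f F G : unit_primitives f F G ->
  forall u v, 0 < u -> 0 < v -> `|F u - F v| <= `|u - v|.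
Proof.
move=> [f1 _ dF _] u v u0 v0; rewrite -[leRHS]mul1r.
by apply: (@is_derive_dist_le `]0, +oo[ F f); rewrite ?in_itv/= ?andbT// => x;
  rewrite in_itv/= andbT; [exact: dF | exact: f1].
Qed.

End MeanValue.

Section Oscillation.
Context {R : realType}.
Implicit Types (t phi u : R).

(* [osc t 0 u] and [osc t (pi / 2) u] are the real and imaginary parts of
   u ^ (- i t). *)
Definition osc t phi u : R := cos (t * ln u + phi).

(* Re (e ^ (- i phi) u ^ (1 - i t) / (1 - i t)) *)
Definition osc_prim t phi u : R :=
  u * (cos (t * ln u + phi) + t * sin (t * ln u + phi)) / (1 + t ^+ 2).

(* Re (e ^ (- i phi) u ^ (2 - i t) / ((1 - i t) (2 - i t))) *)
Definition osc_prim2 t phi u : R :=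
  u ^+ 2 * ((2 - t ^+ 2) * cos (t * ln u + phi) + 3 * t * sin (t * ln u + phi))
  / ((1 + t ^+ 2) * (4 + t ^+ 2)).

Lemma osc_norm_le t phi u : `|osc t phi u| <= 1.
Proof. exact: cos_max. Qed.

Lemma osc_dist_le t t' phi u : 1 <= u ->
  `|osc t phi u - osc t' phi u| <= `|t - t'| * ln u.
Proof.
move=> u1; apply: (le_trans (cos_dist_le _ _)).
by rewrite opprD addrACA subrr addr0 -mulrBl normrM (ger0_norm (ln_ge0 u1)).
Qed.

Lemma measurable_osc t phi : measurable_fun [set: R] (osc t phi).
Proof.
apply: measurableT_comp.
  exact: continuous_measurable_fun (@continuous_cos R).
by apply: measurable_funD => //; apply: measurable_funM.
Qed.

HB.instance Definition _ t phi :=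
  isMeasurableFun.Build _ _ _ _ (osc t phi) (measurable_osc t phi).

Let is_derive_phase t phi u : 0 < u ->
  is_derive u (1 : R^o) (fun v : R => t * ln v + phi) (t / u).
Proof.
move=> u0; have lnd := is_derive1_ln u0.
by apply: is_derive_eq; rewrite addr0 /GRing.scale/= ?mulr0 ?addr0.
Qed.

Lemma is_derive_cos_ln t phi u : 0 < u ->
  is_derive u 1 (fun v => cos (t * ln v + phi))
    (- sin (t * ln u + phi) * (t / u)).
Proof.
move=> /(is_derive_phase t phi) d.
by have := @is_derive1_comp _ (@cos R) _ u _ _ _ d; apply; exact: is_derive_cos.
Qed.

Lemma is_derive_sin_ln t phi u : 0 < u ->
  is_derive u 1 (fun v => sin (t * ln v + phi))
    (cos (t * ln u + phi) * (t / u)).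
Proof.
move=> /(is_derive_phase t phi) d.
by have := @is_derive1_comp _ (@sin R) _ u _ _ _ d; apply; exact: is_derive_sin.
Qed.

Lemma continuous_osc t phi u : 0 < u -> {for u, continuous (osc t phi)}.
Proof.
move=> u0; apply/differentiable_continuous/derivable1_diffP.
exact: (@ex_derive _ _ _ _ _ _ _ (is_derive_cos_ln t phi u0)).
Qed.

Lemma addr_sqr_neq0 (c t : R) : 0 < c -> c + t ^+ 2 != 0.
Proof. by move=> c0; rewrite gt_eqF// ltr_pwDl// sqr_ge0. Qed.

Lemma is_derive_osc_prim t phi u : 0 < u ->
  is_derive u 1 (osc_prim t phi) (osc t phi u).
Proof.
move=> u0; have dc := is_derive_cos_ln t phi u0.
have ds := is_derive_sin_ln t phi u0.
rewrite /osc_prim /osc; apply: is_derive_eq; rewrite /GRing.scale/=.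
by field; rewrite addr_sqr_neq0// gt_eqF.
Qed.

Lemma is_derive_osc_prim2 t phi u : 0 < u ->
  is_derive u 1 (osc_prim2 t phi) (osc_prim t phi u).
Proof.
move=> u0; have dc := is_derive_cos_ln t phi u0.
have ds := is_derive_sin_ln t phi u0.
rewrite /osc_prim /osc_prim2; apply: is_derive_eq; rewrite /GRing.scale/=.
by field; rewrite !addr_sqr_neq0// gt_eqF.
Qed.

Lemma osc_prim_norm_le t phi u : 0 <= u -> `|osc_prim t phi u| <= u.
Proof.
move=> u0; rewrite /osc_prim -mulrA normrM (ger0_norm u0) ler_piMr//.
have t1 : 0 < 1 + t ^+ 2 by rewrite ltr_pwDl// sqr_ge0.
rewrite normrM normfV (gtr0_norm t1) ler_pdivrMr// mul1r.
have := cos2Dsin2 (t * ln u + phi); set c := cos _; set s := sin _ => cs.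
(* Cauchy-Schwarz for (1, t) and (c, s) *)
have : (c + t * s) ^+ 2 <= 1 + t ^+ 2.
  by have := sqr_ge0 (t * c - s); nra.
by move=> h; rewrite ler_norml; apply/andP; split; nra.
Qed.

Lemma unit_primitives_osc t phi :
  unit_primitives (osc t phi) (osc_prim t phi) (osc_prim2 t phi).
Proof.
split=> u u0; first exact: osc_norm_le.
- exact/osc_prim_norm_le/ltW.
- exact: is_derive_osc_prim.
- exact: is_derive_osc_prim2.
Qed.

End Oscillation.

Section PowR.
Context {R : realType}.
Implicit Types a x y : R.

Lemma powR_ge1 x a : 1 <= x -> 0 <= a -> 1 <= x `^ a.
Proof. by move=> x1 a0; rewrite -[leLHS](powRr0 x) ler_powR. Qed.

Lemma le_powR2r x y a : 0 <= a -> 0 <= x -> x <= y -> x `^ a <= y `^ a.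
Proof.
by move=> a0 x0 xy; apply: ge0_ler_powR; rewrite // nnegrE (le_trans x0).
Qed.

Lemma le_powRN2r x y a : 0 <= a -> 0 < x -> x <= y -> y `^ (- a) <= x `^ (- a).
Proof.
move=> a0 x0 xy; have y0 := lt_le_trans x0 xy.
by rewrite !powRN lef_pV2 ?posrE ?powR_gt0// le_powR2r// ltW.
Qed.

Lemma powRB1 x a : 0 < x -> x `^ (a - 1) = x `^ a / x.
Proof.
by move=> x0; rewrite powRB ?(gt_eqF x0) ?implybT// powRr1// ltW.
Qed.

Lemma powR_succ_ge a (n : nat) : 0 < a -> a < 1 ->
  a * n.+1%:R `^ (a - 1) <= n.+1%:R `^ a - n%:R `^ a.
Proof.
move=> a0 a1; case: n => [|n].
  by rewrite !powR1 powR0 ?gt_eqF// mulr1 subr0 ltW.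
have [|x|c /andP[nc cn] ->] := @MVT_is_derive R (fun y => y `^ a)
    (fun y => a * y `^ (a - 1)) n.+1%:R n.+2%:R.
- by rewrite ler_nat.
- by move=> /andP[nx _]; apply: is_derive1_powR; apply: lt_le_trans nx.
have c0 : 0 < c by apply: lt_le_trans nc.
rewrite -natrB// subSnn mulr1 ler_pM2l// -[a - 1]opprB.
by rewrite le_powRN2r// subr_ge0 ltW.
Qed.

Lemma sum_powR_le a (m n : nat) : 0 < a -> a < 1 -> (0 < m)%N ->
  \sum_(m <= j < n) j%:R `^ (a - 1) <= n%:R `^ a / a.
Proof.
move=> a0 a1 m0; rewrite ler_pdivlMr// mulrC.
suff sum_le k : a * \sum_(m <= j < k.+1) j%:R `^ (a - 1) <= k%:R `^ a.
  case: n => [|n]; first by rewrite big_geq// mulr0 powR_ge0.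
  by apply: (le_trans (sum_le n)); rewrite le_powR2r ?(ltW a0) ?ler_nat.
elim: k => [|k IHk]; first by rewrite big_geq// mulr0 powR_ge0.
have [mk|km] := leqP m k.+1; last by rewrite big_geq// mulr0 powR_ge0.
rewrite big_nat_recr//= mulrDr -lerBrDr (le_trans IHk)// lerBrDr -lerBrDl.
exact: powR_succ_ge.
Qed.

Lemma truncnS_powR_le b x a : 0 < b -> 1 <= x -> 0 <= a -> a <= 1 ->
  (Num.truncn (b * x)).+1%:R `^ a <= (b + 1) * x `^ a.
Proof.
move=> b0 x1 a0 a1; have x0 : 0 <= x by exact: le_trans ler01 x1.
have b1 : 1 <= b + 1 by rewrite lerDr ltW.
apply: (@le_trans _ _ (((b + 1) * x) `^ a)).
  rewrite le_powR2r// mulrDl mul1r -natr1 lerD//.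
  by rewrite truncn_le// mulr_ge0// ltW.
by rewrite powRM ?(le_trans ler01 b1)// ler_wpM2r ?powR_ge0// ler1_powR.
Qed.

End PowR.

Section Windows.
Context {R : realType}.
Variables A K theta : R.
Hypotheses (A0 : 0 < A) (K0 : 0 < K) (theta0 : 0 < theta) (theta1 : theta < 1).
Implicit Types (f F G H h : R -> R) (c u x y z : R).

Definition window_lo y := y / A - K * y `^ theta.
Definition window_hi y := y / A + K * y `^ theta.

(* The two thresholds make K y ^ theta <= y / (2 A) and 1 <= y / (2 A). *)
Definition window_start : nat :=
  (Num.truncn (Num.max ((2 * A * K) `^ (1 - theta)^-1) (2 * A))).+2.

Let le_window_start z :
  z <= Num.max ((2 * A * K) `^ (1 - theta)^-1) (2 * A) -> z <= window_start%:R.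
Proof.
move=> zm; apply/(le_trans zm)/ltW/(lt_le_trans (truncnS_gt _)).
by rewrite ler_nat.
Qed.

Let large y := window_start%:R <= y.

Lemma window_start_ge1 y : large y -> 1 <= y.
Proof. by apply: le_trans; rewrite ler1n. Qed.

Let large_gt0 y : large y -> 0 < y.
Proof. by move=> /window_start_ge1; exact: lt_le_trans. Qed.

Lemma window_lo_ge y : large y -> y <= 2 * A * window_lo y.
Proof.
move=> yl; have y0 := large_gt0 yl; have t1 : 0 < 1 - theta by rewrite subr_gt0.
have AKy : 2 * A * K <= y `^ (1 - theta).
  have -> : 2 * A * K = ((2 * A * K) `^ (1 - theta)^-1) `^ (1 - theta).
    by rewrite -powRrM mulVf ?gt_eqF// powRr1// !mulr_ge0 ?ltW.
  rewrite le_powR2r ?powR_ge0 ?(ltW t1)//; apply: le_trans yl.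
  by rewrite le_window_start// le_max lexx.
have yE : y = y `^ theta * y `^ (1 - theta).
  by rewrite -powRD ?(gt_eqF y0) ?implybT// addrC subrK powRr1 ?ltW.
have -> : 2 * A * window_lo y = 2 * y - 2 * A * K * y `^ theta.
  by rewrite /window_lo; field; rewrite gt_eqF.
have : 2 * A * K * y `^ theta <= y.
  by rewrite [leRHS]yE mulrC ler_pM2l ?powR_gt0.
lra.
Qed.

Lemma window_lo_ge1 y : large y -> 1 <= window_lo y.
Proof.
move=> yl; have A2 : 0 < 2 * A by rewrite mulr_gt0.
rewrite -(ler_pM2l A2) mulr1.
apply: le_trans (window_lo_ge yl); apply: le_trans yl.
by rewrite le_window_start// le_max lexx orbT.
Qed.

Let window_lo_gt0 y : large y -> 0 < window_lo y.
Proof. by move=> /window_lo_ge1; exact: lt_le_trans. Qed.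

Lemma window_hi_sub_lo y : window_hi y - window_lo y = 2 * K * y `^ theta.
Proof. by rewrite /window_hi /window_lo; ring. Qed.

Lemma window_lo_lt_hi y : 0 < y -> window_lo y < window_hi y.
Proof.
by move=> y0; rewrite -subr_gt0 window_hi_sub_lo !mulr_gt0// powR_gt0.
Qed.

Lemma window_hi_le y : large y -> window_hi y <= 2 / A * y.
Proof.
move=> yl; have -> : window_hi y = 2 / A * y - window_lo y.
  by rewrite /window_hi /window_lo; ring.
by rewrite gerBl ltW// window_lo_gt0.
Qed.

Definition secant H y :=
  (H (window_hi y) - H (window_lo y)) / (2 * K * y `^ theta).

Definition secant_deriv H h y :=
  (h (window_hi y) - h (window_lo y)) / (2 * A * K * y `^ theta)
  + theta / (2 * y) * (h (window_hi y) + h (window_lo y) - 2 * secant H y).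

Lemma is_derive_secant H h y : large y ->
  (forall u : R, 0 < u -> is_derive u 1 H (h u)) ->
  is_derive y 1 (secant H) (secant_deriv H h y).
Proof.
move=> yl dH; have y0 := large_gt0 yl.
have w0 : 0 < y `^ theta := powR_gt0 _ y0.
have l0 := window_lo_gt0 yl.
have h0 : 0 < window_hi y by exact: lt_trans (window_lo_lt_hi y0).
have dp : is_derive y (1 : R^o) (fun z => z `^ theta)
    (theta * (y `^ theta / y)).
  by rewrite -powRB1//; exact: is_derive1_powR.
have dhi : is_derive y (1 : R^o) window_hi
    (A^-1 + K * (theta * (y `^ theta / y))).
  by rewrite /window_hi; apply: is_derive_eq; rewrite /GRing.scale/=; ring.
have dlo : is_derive y (1 : R^o) window_lo
    (A^-1 - K * (theta * (y `^ theta / y))).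
  by rewrite /window_lo; apply: is_derive_eq; rewrite /GRing.scale/=; ring.
have dHhi := @is_derive1_comp _ H window_hi y _ _ (dH _ h0) dhi.
have dHlo := @is_derive1_comp _ H window_lo y _ _ (dH _ l0) dlo.
have dw : is_derive y (1 : R^o) (fun z => 2 * K * z `^ theta)
    (2 * K * (theta * (y `^ theta / y))).
  by apply: is_derive_eq; rewrite /GRing.scale/=; ring.
have w_neq0 : 2 * K * y `^ theta != 0 by rewrite !mulf_neq0// gt_eqF.
have dV := @is_deriveV _ (fun z => 2 * K * z `^ theta) _ _ _ w_neq0 dw.
apply: is_derive_eq; rewrite /secant_deriv /secant /GRing.scale/=.
by field; rewrite !gt_eqF.
Qed.

Lemma secant_mean H h y : large y ->
  (forall u : R, 0 < u -> is_derive u 1 H (h u)) ->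
  exists2 c, window_lo y <= c <= window_hi y & secant H y = h c.
Proof.
move=> yl dH; have y0 := large_gt0 yl; have lh := window_lo_lt_hi y0.
have [x /andP[lx _]|c cy E] := @MVT_is_derive R H h _ _ (ltW lh).
  by apply: dH; apply: lt_le_trans lx; exact: window_lo_gt0.
exists c; rewrite // /secant E window_hi_sub_lo mulfK//.
by rewrite -window_hi_sub_lo subr_eq0 gt_eqF.
Qed.

Section MeanSum.
Variables f F G : R -> R.
Hypothesis fFG : unit_primitives f F G.

Let f_norm_le y c : large y -> window_lo y <= c -> `|f c| <= 1.
Proof.
have [f1 _ _ _] := fFG.
by move=> yl yc; apply/f1/(lt_le_trans (window_lo_gt0 yl)).
Qed.

Let dF u : 0 < u -> is_derive u 1 F (f u).
Proof. by case: fFG => _ _ + _; apply. Qed.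

Let dG u : 0 < u -> is_derive u 1 G (F u).
Proof. by case: fFG => _ _ _; apply. Qed.

Lemma secant_norm_le y : large y -> `|secant F y| <= 1.
Proof.
move=> yl; have [c /andP[yc _] ->] := secant_mean yl dF; exact: f_norm_le yl yc.
Qed.

Lemma secant_deriv_norm_le y : large y ->
  `|secant_deriv F f y| <= ((A * K)^-1 + 2) * y `^ (- theta).
Proof.
move=> yl; have y0 := large_gt0 yl; have lh := window_lo_lt_hi y0.
have p0 : 0 < y `^ theta by exact: powR_gt0.
have AK : 0 < A * K by rewrite mulr_gt0.
rewrite /secant_deriv; set S := secant F y.
set a := f (window_hi y); set b := f (window_lo y).
have /andP[a1 a2] : -1 <= a <= 1 by rewrite -ler_norml (f_norm_le yl)// ltW.
have /andP[b1 b2] : -1 <= b <= 1 by rewrite -ler_norml (f_norm_le yl).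
have /andP[S1 S2] : -1 <= S <= 1 by rewrite -ler_norml secant_norm_le.
have -> : (a - b) / (2 * A * K * y `^ theta)
    + theta / (2 * y) * (a + b - 2 * S) =
    (a - b) / 2 * ((A * K)^-1 / y `^ theta) + theta * ((a + b) / 2 - S) * y^-1.
  by field; rewrite !gt_eqF.
rewrite powRN [leRHS]mulrDl; apply: (le_trans (ler_normD _ _)).
apply: lerD; rewrite normrM.
  rewrite (gtr0_norm (x := _ / y `^ theta)) ?divr_gt0 ?invr_gt0//.
  apply: ler_piMl; first by rewrite divr_ge0 ?invr_ge0 ?ltW.
  by rewrite ler_norml; apply/andP; split; lra.
rewrite normfV (gtr0_norm y0); apply: ler_pM; rewrite ?invr_ge0 ?(ltW y0)//.
  rewrite normrM (gtr0_norm theta0) (le_trans (ler_piMl _ (ltW theta1)))//.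
  by rewrite ler_norml; apply/andP; split; lra.
by rewrite lef_pV2 ?posrE// ler1_powR ?(ltW theta1)// window_start_ge1.
Qed.

Lemma secant_dist_le y z : large y -> y <= z ->
  `|secant F z - secant F y| <= ((A * K)^-1 + 2) * y `^ (- theta) * (z - y).
Proof.
move=> yl yz; rewrite -(ger0_norm (x := z - y)) ?subr_ge0//.
have C0 : 0 <= (A * K)^-1 + 2 by rewrite addr_ge0// invr_ge0 mulr_ge0 ?ltW.
apply: (@is_derive_dist_le _ `[y, +oo[ _ (secant_deriv F f));
  rewrite ?in_itv/= ?lexx ?yz//.
- move=> x; rewrite in_itv/= andbT => /(le_trans yl) xl.
  exact: is_derive_secant.
- move=> x; rewrite in_itv/= andbT => yx.
  apply: (le_trans (secant_deriv_norm_le (le_trans yl yx))).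
  by rewrite ler_wpM2l// le_powRN2r ?(ltW theta0) ?large_gt0.
Qed.

Lemma secant_deriv_dist_le y : large y ->
  `|A * secant_deriv G F y - secant F y| <= A * K * y `^ (theta - 1).
Proof.
move=> yl; have y0 := large_gt0 yl.
have l0 := window_lo_gt0 yl; have lh := window_lo_lt_hi y0.
have p0 : 0 < y `^ theta by exact: powR_gt0.
have [c /andP[lc ch] E] := secant_mean yl dG.
have lip := unit_primitives_dist_le fFG.
have Dhi : `|F (window_hi y) - F c| <= window_hi y - c.
  by rewrite -[leRHS]ger0_norm ?subr_ge0// lip// (lt_le_trans l0)// ltW.
have Dlo : `|F (window_lo y) - F c| <= c - window_lo y.
  rewrite -[leRHS]ger0_norm ?subr_ge0// [leRHS]distrC lip//.
  exact: lt_le_trans lc.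
have -> : A * secant_deriv G F y - secant F y =
    A / (2 * y) * (theta * ((F (window_hi y) - F c) + (F (window_lo y) - F c))).
  by rewrite /secant_deriv E /secant; field; rewrite !gt_eqF.
have -> : A * K * y `^ (theta - 1) = A / (2 * y) * (2 * K * y `^ theta).
  by rewrite powRB1//; field; rewrite gt_eqF.
have Ay : 0 <= A / (2 * y) by rewrite divr_ge0 ?mulr_ge0 ?ltW.
rewrite normrM (ger0_norm Ay) ler_wpM2l// normrM (gtr0_norm theta0).
apply: (le_trans (ler_piMl _ (ltW theta1))) => //.
rewrite -window_hi_sub_lo; apply: (le_trans (ler_normD _ _)).
by apply: (le_trans (lerD Dhi Dlo)); rewrite addrA subrK.
Qed.

Lemma secant_step_le (j : nat) : (window_start <= j)%N ->
  `|A * secant G j.+1%:R - A * secant G j%:R - secant F j%:R|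
  <= A * K * j%:R `^ (theta - 1) + ((A * K)^-1 + 2) * j%:R `^ (1 - theta - 1).
Proof.
move=> jl; have {}jl : large j%:R by rewrite /large ler_nat.
have js : (j.+1%:R : R) = j%:R + 1 by rewrite -natr1.
have [|x /andP[/(le_trans jl) xl _]|c /andP[jc cj]] :=
  @MVT_is_derive R (fun y => A * secant G y) (fun y => A * secant_deriv G F y)
    j%:R j.+1%:R.
- by rewrite ler_nat.
- by have d := is_derive_secant xl dG; exact: is_deriveZ d.
rewrite [X in _ * (X - _)]js addrAC subrr add0r mulr1 => ->.
have cl : large c by exact: le_trans jc.
rewrite -(subrKA (secant F c)); apply: (le_trans (ler_normD _ _)); apply: lerD.
  apply: (le_trans (secant_deriv_dist_le cl)).
  rewrite -[theta - 1]opprB ler_wpM2l ?mulr_ge0 ?(ltW A0) ?(ltW K0)//.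
  by rewrite le_powRN2r ?subr_ge0 ?(ltW theta1) ?large_gt0.
have -> : 1 - theta - 1 = - theta by ring.
apply: (le_trans (secant_dist_le jl jc)); rewrite ler_piMr//; last by lra.
by rewrite mulr_ge0 ?powR_ge0// addr_ge0// invr_ge0 mulr_ge0 ?ltW.
Qed.

Lemma sum_secant_telescope_le (n : nat) : (window_start <= n)%N ->
  `|\sum_(window_start <= j < n) secant F j%:R
    - (A * secant G n%:R - A * secant G window_start%:R)|
  <= A * K * (n%:R `^ theta / theta)
     + ((A * K)^-1 + 2) * (n%:R `^ (1 - theta) / (1 - theta)).
Proof.
move=> ln; rewrite -(telescope_sumr (fun j => A * secant G j%:R) ln) -sumrB.
apply: (le_trans (ler_norm_sum _ _ _)).
apply: (@le_trans _ _ (\sum_(window_start <= j < n) (A * K * j%:R `^ (theta - 1)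
    + ((A * K)^-1 + 2) * j%:R `^ (1 - theta - 1)))).
  by apply: ler_sum_nat => j /andP[lj _]; rewrite distrC; exact: secant_step_le.
have t1 : 0 < 1 - theta by rewrite subr_gt0.
have AK : 0 <= A * K by rewrite mulr_ge0 ?ltW.
rewrite big_split/= -!mulr_sumr.
by apply: lerD; rewrite ler_wpM2l ?addr_ge0 ?invr_ge0// sum_powR_le// gtrBl.
Qed.

Lemma secant_prim_dist_le u y : 0 < u -> large y ->
  `|secant G y - F u| <= `|y / A - u| + K * y `^ theta.
Proof.
move=> u0 yl; have [c /andP[lc ch] ->] := secant_mean yl dG.
have c0 : 0 < c by exact: lt_le_trans (window_lo_gt0 yl) lc.
apply: (le_trans (unit_primitives_dist_le fFG c0 u0)).
rewrite -(subrKA (y / A)) addrC; apply: (le_trans (ler_normD _ _)).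
by rewrite lerD2l ler_norml; move: lc ch; rewrite /window_lo /window_hi; lra.
Qed.

Lemma secant_prim_norm_le y : large y -> A * `|secant G y| <= 2 * y.
Proof.
have [_ Fu _ _] := fFG.
move=> yl; have [c /andP[lc ch] ->] := secant_mean yl dG.
have c0 : 0 < c by exact: lt_le_trans (window_lo_gt0 yl) lc.
rewrite mulrC -ler_pdivlMr// (le_trans (Fu _ c0))// (le_trans ch)//.
by rewrite (le_trans (window_hi_le yl))// mulrAC.
Qed.

Lemma sum_secant_prim_dist_le u (n : nat) : 0 < u -> (window_start <= n)%N ->
  `|\sum_(window_start <= j < n) secant F j%:R - A * F u|
  <= A * K * (n%:R `^ theta / theta)
     + ((A * K)^-1 + 2) * (n%:R `^ (1 - theta) / (1 - theta))
     + A * (`|n%:R / A - u| + K * n%:R `^ theta) + 2 * window_start%:R.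
Proof.
move=> u0 sn; have nl : large n%:R by rewrite /large ler_nat.
set S := \sum_(_ <= _ < _) _; set s : R := window_start%:R.
have -> : S - A * F u = S - (A * secant G n%:R - A * secant G s)
    + A * (secant G n%:R - F u) - A * secant G s by ring.
apply: (le_trans (ler_normB _ _)); apply: lerD; last first.
  by rewrite normrM (gtr0_norm A0) secant_prim_norm_le// /large.
apply: (le_trans (ler_normD _ _)); apply: lerD.
  exact: sum_secant_telescope_le.
by rewrite normrM (gtr0_norm A0) ler_wpM2l ?(ltW A0)// secant_prim_dist_le.
Qed.

End MeanSum.

Lemma sum_secant_dist_le : exists2 C : R, 0 <= C & forall f F G x,
  unit_primitives f F G -> 1 <= x ->
  `|\sum_(window_start <= j < (Num.truncn (A * x)).+1) secant F j%:R - A * F x|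
  <= C * (x `^ theta + x `^ (1 - theta)).
Proof.
have t1 : 0 < 1 - theta by rewrite subr_gt0.
have AK : 0 < A * K by rewrite mulr_gt0.
pose s : R := window_start%:R; have s0 : 0 <= s by [].
pose C1 := A * K / theta * (A + 1) + A * K * (A + 1).
pose C2 := ((A * K)^-1 + 2) / (1 - theta) * (A + 1).
have C10 : 0 <= C1 by rewrite addr_ge0// !mulr_ge0 ?invr_ge0 ?addr_ge0 ?ltW.
have C20 : 0 <= C2 by rewrite !mulr_ge0 ?addr_ge0 ?invr_ge0 ?ltW.
exists (C1 + C2 + 2 * s + 1) => [|f F G x fFG x1]; first by lra.
have x0 : 0 < x by exact: lt_le_trans x1.
have Ax : 0 <= A * x by rewrite mulr_ge0 ?ltW.
set n := (Num.truncn (A * x)).+1; have /andP[nu nl] := truncn_itv Ax.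
set p := x `^ theta; set q := x `^ (1 - theta).
have p1 : 1 <= p by rewrite powR_ge1// ltW.
have q1 : 1 <= q by rewrite powR_ge1// ltW.
have [/ltnW ns|sn] := ltnP n window_start.
  have [_ Fu _ _] := fFG.
  rewrite big_geq// sub0r normrN normrM (gtr0_norm A0).
  apply: (@le_trans _ _ s); last by nra.
  apply: (@le_trans _ _ (A * x)); first by rewrite ler_pM2l// Fu.
  by apply: (le_trans (ltW nl)); rewrite ler_nat.
apply: (le_trans (sum_secant_prim_dist_le fFG x0 sn)); rewrite -/s.
have np : n%:R `^ theta <= (A + 1) * p by rewrite truncnS_powR_le// ltW.
have nq : n%:R `^ (1 - theta) <= (A + 1) * q.
  by rewrite truncnS_powR_le ?(ltW t1)// gerBl ltW.
have nx : A * `|n%:R / A - x| <= 1.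
  rewrite -{1}(gtr0_norm A0) -normrM mulrBr mulrCA mulfV ?gt_eqF// mulr1.
  by rewrite -natr1 ler_norml; apply/andP; split; lra.
have theta_part : A * K * (n%:R `^ theta / theta) + A * (K * n%:R `^ theta)
    <= C1 * p.
  have -> : C1 * p = A * K * ((A + 1) * p / theta) + A * (K * ((A + 1) * p)).
    by rewrite /C1; ring.
  by apply: lerD; rewrite !ler_pM2l// ler_pM2r ?invr_gt0.
have cotheta_part :
    ((A * K)^-1 + 2) * (n%:R `^ (1 - theta) / (1 - theta)) <= C2 * q.
  have -> : C2 * q = ((A * K)^-1 + 2) * ((A + 1) * q / (1 - theta)).
    by rewrite /C2; ring.
  by rewrite ler_pM2l ?addr_gt0 ?invr_gt0// ler_pM2r ?invr_gt0.
rewrite mulrDr; nra.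
Qed.

End Windows.

Section Indices.
Context {R : realType}.
Implicit Types (f s : nat -> R) (x y r : R).

Lemma norm_sum_nat_le f (b : R) (m n : nat) :
  (forall j, (m <= j < n)%N -> `|f j| <= b) ->
  `|\sum_(m <= j < n) f j| <= b *+ (n - m).
Proof.
move=> fb; apply: (le_trans (ler_norm_sum _ _ _)).
by rewrite -sumr_const_nat; exact: ler_sum_nat.
Qed.

Lemma sum_nat_start_dist_le f (m n : nat) : (0 < m)%N ->
  (forall j, (0 < j)%N -> `|f j| <= 1) ->
  `|\sum_(1 <= j < n) f j - \sum_(m <= j < n) f j| <= m%:R.
Proof.
move=> m0 f1; have f1' j k l : (k.+1 <= j < l)%N -> `|f j| <= 1.
  by move=> /andP[kj _]; rewrite f1// (leq_trans _ kj).
have [mn|/ltnW nm] := leqP m n.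
  rewrite (big_cat_nat m0 mn)/= addrK; apply: (le_trans (norm_sum_nat_le _)).
    by move=> j; exact: f1'.
  by rewrite ler_nat leq_subr.
rewrite [X in _ - X]big_geq// subr0; apply: (le_trans (norm_sum_nat_le _)).
  by move=> j; exact: f1'.
by rewrite ler_nat (leq_trans _ nm)// leq_subr.
Qed.

Lemma fsum_indices_le (V : nmodType) (f : nat -> V) s x (m : nat) :
  (forall j, (0 < j)%N -> s j <= x -> (j < m)%N) ->
  finite_set (indices_le s x) /\
  \sum_(j \in indices_le s x) f j = \sum_(1 <= j < m | s j <= x) f j.
Proof.
move=> sm.
have -> : indices_le s x = [set` [seq j <- index_iota 1 m | s j <= x]].
  apply/seteqP; split=> j /=; rewrite mem_filter mem_index_iota.
    by move=> [j0 sx]; rewrite sx j0 sm.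
  by move=> /and3P[].
by rewrite -fsbig_seq ?filter_uniq ?iota_uniq// big_filter.
Qed.

Lemma counting_funE s x : finite_set (indices_le s x) ->
  (counting_fun s x)%:R = \sum_(j \in indices_le s x) (1 : R).
Proof.
move=> fin; rewrite fsbig_finite//.
by rewrite /counting_fun big_const_seq count_predT iter_addr_0 cardfE.
Qed.

Definition indices_near s x y r : Prop := forall j, (0 < j)%N ->
  (s j <= x -> j%:R <= y + r) /\ (j%:R <= y - r -> s j <= x).

Lemma fsum_indices_near s x y r : 0 <= y -> 0 <= r -> indices_near s x y r ->
  finite_set (indices_le s x) /\
  forall f, (forall j, (0 < j)%N -> `|f j| <= 1) ->
  `|\sum_(j \in indices_le s x) f j - \sum_(1 <= j < (Num.truncn y).+1) f j|
  <= 2 * r + 1.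
Proof.
move=> y0 r0 near; set J := Num.truncn y.
pose L := Num.truncn (y - r); pose M := Num.truncn (y + r).
have sM j : (0 < j)%N -> s j <= x -> (j < M.+1)%N.
  by move=> j0 /(near j j0).1 jy; rewrite ltnS truncn_ge_nat// addr_ge0.
split=> [|f f1]; first by have [] := fsum_indices_le (fun=> 0 : R) sM.
have [_ ->] := fsum_indices_le f sM.
have JM : (J <= M)%N by rewrite le_truncn// lerDl.
have LJ : (L <= J)%N by rewrite le_truncn// gerBl.
rewrite (big_nat_widen 1 J.+1 M.+1)//.
rewrite big_mkcond/= [X in _ - X]big_mkcond/= -sumrB.
have LM : (L.+1 <= M.+1)%N := leq_trans LJ JM.
rewrite (big_cat_nat _ LM)//= big_nat_cond big1; last first.
  move=> j /andP[/andP[j0 jL] _].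
  have jJ : (j < J.+1)%N by exact: leq_trans jL _.
  rewrite jJ (near j j0).2 ?subrr//.
  by rewrite -(prednK j0) -truncn_gt_nat prednK.
rewrite add0r.
apply: (le_trans (norm_sum_nat_le (b := 1) _)) => [j /andP[Lj _]|].
  have j0 : (0 < j)%N by exact: leq_trans Lj.
  by case: ifP; case: ifP; rewrite ?subrr ?subr0 ?sub0r ?normrN ?normr0 ?f1.
rewrite subSS natrB ?(leq_trans LJ)// lerBlDr.
have ML : M%:R <= y + r by rewrite truncn_le// addr_ge0.
have : y - r < L%:R + 1 by rewrite natr1 truncnS_gt.
lra.
Qed.

End Indices.

Section WindowIndices.
Context {R : realType}.
Variables A K theta : R.
Hypotheses (A0 : 0 < A) (K0 : 0 < K) (theta0 : 0 < theta) (theta1 : theta < 1).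
Implicit Types (s f : nat -> R) (x : R).

Definition in_windows s := forall j, (0 < j)%N ->
  sel_lo A K theta j < s j <= sel_hi A K theta j.

Lemma in_windows_gt_lo s j : in_windows s -> (0 < j)%N ->
  window_lo A K theta j%:R < s j.
Proof.
move=> sw /sw/andP[+ _]; apply: le_lt_trans.
by rewrite le_max lexx orbT.
Qed.

Lemma in_windows_gt0 s j : in_windows s -> (0 < j)%N -> 0 < s j.
Proof.
move=> sw /sw/andP[+ _]; apply: le_lt_trans.
by rewrite le_max lexx.
Qed.

Lemma in_windows_indices_near : exists2 C : R, 0 <= C & forall s x,
  in_windows s -> 1 <= x -> indices_near s x (A * x) (C * x `^ theta).
Proof.
pose st : R := (window_start A K theta)%:R; pose B := 2 * A + st.
have B0 : 0 <= B by rewrite addr_ge0// mulr_ge0// ltW.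
exists (A * K * B `^ theta) => [|s x sw x1 j j0].
  by rewrite !mulr_ge0 ?powR_ge0 ?ltW.
have x0 : 0 < x by exact: lt_le_trans x1.
have stx : 0 <= st * x by rewrite mulr_ge0// ltW.
have Ax : 0 <= A * x by rewrite mulr_ge0// ltW.
have jpow : j%:R <= B * x ->
    A * (K * j%:R `^ theta) <= A * K * B `^ theta * x `^ theta.
  move=> jx; rewrite -!mulrA ler_pM2l// ler_pM2l// -powRM// ?(ltW x0)//.
  by rewrite le_powR2r// ltW.
have /andP[_ sh] := sw _ j0; have sl := in_windows_gt_lo sw j0; split=> sx.
- have lox : window_lo A K theta j%:R <= x by rewrite (le_trans (ltW sl)).
  have jB : j%:R <= B * x.
    have [stj|jst] := leP st (j%:R : R).
      apply: (le_trans (window_lo_ge A0 K0 theta1 stj)).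
      apply: (@le_trans _ _ (2 * A * x)); last by rewrite [leRHS]mulrDl lerDl.
      by rewrite ler_wpM2l// mulr_ge0// ltW.
    have : st <= st * x by rewrite ler_peMr.
    by rewrite /B; lra.
  apply: (@le_trans _ _ (A * x + A * (K * j%:R `^ theta))); last first.
    by rewrite lerD2l jpow.
  by rewrite -mulrDr -ler_pdivrMl// mulrC -lerBlDr.
- apply: (le_trans sh); rewrite /sel_hi -(ler_pM2l A0) mulrDr mulrCA.
  rewrite mulfV ?gt_eqF// mulr1.
  have C0 : 0 <= A * K * B `^ theta * x `^ theta.
    by rewrite !mulr_ge0 ?powR_ge0 ?ltW.
  have /jpow : j%:R <= B * x by rewrite /B; lra.
  lra.
Qed.

Lemma in_windows_fsum_dist : exists2 C : R, 0 <= C & forall s x,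
  in_windows s -> 1 <= x -> finite_set (indices_le s x) /\
  forall f, (forall j, (0 < j)%N -> `|f j| <= 1) ->
  `|\sum_(j \in indices_le s x) f j
    - \sum_(1 <= j < (Num.truncn (A * x)).+1) f j|
  <= C * x `^ theta.
Proof.
have [C C0 near] := in_windows_indices_near.
exists (2 * C + 1) => [|s x sw x1]; first by rewrite addr_ge0// mulr_ge0.
have [||fin dist] := fsum_indices_near _ _ (near s x sw x1).
- by rewrite mulr_ge0 ?(ltW A0)// (le_trans _ x1).
- by rewrite mulr_ge0 ?powR_ge0.
split=> // f /dist/le_trans; apply; have := powR_ge1 x1 (ltW theta0); lra.
Qed.

Lemma counting_fun_in_windows : exists C : R, forall s x,
  in_windows s -> 1 <= x -> finite_set (indices_le s x) /\
  `|(counting_fun s x)%:R - A * x| <= C * x `^ theta.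
Proof.
have [C C0 dist] := in_windows_fsum_dist; exists (C + 1) => s x sw x1.
have [fin /(_ (fun=> 1)) dist1] := dist s x sw x1; split=> //.
move: dist1; rewrite -(counting_funE fin) sumr_const_nat subn1/= normr1.
move=> /(_ (fun _ _ => lexx _)) count_dist.
have /truncn_itv/andP[Jl Ju] : 0 <= A * x.
  by rewrite mulr_ge0 ?(ltW A0)// (le_trans ler01).
rewrite -(subrKA (Num.truncn (A * x))%:R); apply: (le_trans (ler_normD _ _)).
rewrite mulrDl mul1r; apply: lerD => //.
apply: le_trans (powR_ge1 x1 (ltW theta0)).
by rewrite -natr1 in Ju; rewrite ler_norml; lra.
Qed.

End WindowIndices.

Section LayerCake.
Context {R : realType} {d : measure_display} {T : measurableType d}.
Variable mu : {sigma_finite_measure set T -> \bar R}.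
Implicit Types (S : T -> \bar R) (Z : {mfun T >-> R}).
Local Open Scope ereal_scope.

Lemma ge0_integral_layer_cake S Z :
  measurable_fun setT S -> (forall w, 0 <= S w) -> (forall w, (0 <= Z w)%R) ->
  \int[mu]_w (S w * (Z w)%:E) =
  \int[@lebesgue_measure R]_(r in `[0%R, +oo[)
    \int[mu]_(w in Z @^-1` `]r, +oo[) S w.
Proof.
move=> mS S0 Z0; pose RR := measurableTypeR R.
pose E : set (T * RR) := [set p | 0 <= p.2 < Z p.1]%R.
have mE : measurable E.
  have -> : E = (fun p => (0 <= p.2)%R) @^-1` [set true] `&`
      (fun p => (p.2 < Z p.1)%R) @^-1` [set true].
    by apply/seteqP; split => p /andP.
  apply: measurableI; rewrite -[X in measurable X]setTI.
  - by apply: (@measurable_fun_ler _ _ _ setT (cst 0%R) snd).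
  - apply: (@measurable_fun_ltr _ _ _ setT snd (Z \o fst)) => //.
    exact: measurableT_comp.
have indicE_itv w r : \1_E (w, r) = \1_`[0%R, Z w[ r :> R.
  by rewrite !indicE; congr (_%:R); apply/idP/idP; rewrite !inE /E/= in_itv.
have m1E : measurable_fun [set: T * RR] (fun p => (\1_E p : R)%:E).
  by apply/measurable_EFinP; exact: measurable_indic.
transitivity (\int[mu]_w \int[@lebesgue_measure R]_r (S w * (\1_E (w, r))%:E)).
  apply: eq_integral => w _.
  have m1Ew : measurable_fun [set: RR] (fun r => (\1_E (w, r) : R)%:E).
    exact: measurableT_comp m1E (pair1_measurable w).
  rewrite ge0_integralZl//; congr (_ * _).
  under eq_integral do rewrite indicE_itv.
  rewrite integral_indic// setIT [RHS](lebesgue_measure_itv `[0%R, Z w[)/=.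
  rewrite lte_fin sube0.
  by have := Z0 w; rewrite le_eqVlt => /predU1P[<-|->]; rewrite ?ltxx.
rewrite (@fubini_tonelli _ _ T RR R mu (@lebesgue_measure R)
  (fun p => S p.1 * (\1_E p)%:E)).
- rewrite [RHS]integral_mkcond; apply: eq_integral => r _.
  rewrite patchE; case: ifPn; rewrite ?inE ?notin_setE/= in_itv/= andbT => r0.
    rewrite [RHS]integral_mkcond; apply: eq_integral => w _.
    rewrite patchE indicE; have -> : ((w, r) \in E) = (w \in Z @^-1` `]r, +oo[).
      by apply/idP/idP; rewrite !inE /E/= in_itv/= andbT r0.
    by case: ifP; rewrite ?mule1 ?mule0.
  rewrite integral0_eq// => w _; rewrite indicE memNset ?mule0//.
  by move=> /andP[].
- apply: emeasurable_funM => //.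
  exact: measurableT_comp mS measurable_fst.
- by move=> p; rewrite mule_ge0// lee_fin.
Qed.

Lemma ge0_integral_mul_proportional S Z (c : \bar R) :
  measurable_fun setT S -> (forall w, 0 <= S w) -> (forall w, (0 <= Z w)%R) ->
  0 <= c ->
  (forall r,
    \int[mu]_(w in Z @^-1` `]r, +oo[) S w = c * mu (Z @^-1` `]r, +oo[)) ->
  \int[mu]_w (S w * (Z w)%:E) = c * \int[mu]_w (Z w)%:E.
Proof.
move=> mS S0 Z0 c0 Sc; rewrite -ge0_integralZl//; last 2 first.
- exact/measurable_EFinP.
- by move=> w _; rewrite lee_fin.
rewrite ge0_integral_layer_cake// (@ge0_integral_layer_cake (cst c))//.
apply: eq_integral => r _; rewrite Sc integral_cst//.
by rewrite -[X in measurable X]setTI; exact: measurable_funPT.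
Qed.

End LayerCake.

Section IndependentProducts.
Context {R : realType} {d : measure_display} {T : measurableType d}.
Variables (P : probability T R) (I : choiceType) (J : set I).
Implicit Types (X : I -> {RV P >-> R}) (F : {fset I}) (B : I -> set R).
Local Open Scope ereal_scope.

Lemma mutually_independent_comp X (g : I -> {mfun R >-> R}) :
  mutually_independent J X ->
  mutually_independent J (fun i => g i \o X i : {RV P >-> R}).
Proof.
move=> indep F B FJ mB.
apply: (indep F (fun i => g i @^-1` B i)) => // i iF.
by rewrite -[X in measurable X]setTI; exact: (measurable_funPT (g i)) (mB i iF).
Qed.

Lemma mutually_independentS X (J' : set I) :
  J' `<=` J -> mutually_independent J X -> mutually_independent J' X.
Proof. by move=> J'J indep F B FJ'; apply: indep; exact: subset_trans J'J. Qed.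

Let event X F B : set T := \bigcap_(i in [set` F]) (X i @^-1` B i).

Let measurable_event X F B : (forall i, i \in F -> measurable (B i)) ->
  measurable (event X F B).
Proof.
move=> mB; apply: fin_bigcap_measurable => [|i iF]; first exact: finite_fset.
by rewrite -[X in measurable X]setTI; apply: measurable_funPT => //; exact: mB.
Qed.

Let event_fsetU1 X F B i C : i \notin F ->
  event X (i |` F)%fset [eta B with i |-> C] = X i @^-1` C `&` event X F B.
Proof.
move=> iF; apply/seteqP; split=> w /=.
  move=> wBC; split.
    by have := wBC i; rewrite /= eqxx; apply; rewrite !inE eqxx.
  move=> k /= kF; have := wBC k; rewrite /= !inE kF orbT => /(_ isT).
  by case: eqP => // ki; rewrite -ki kF in iF.
move=> [wC wB] k /=; rewrite !inE; case: eqP => [-> //|_ kF]; exact: wB.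
Qed.

Let measurable_with F B i C : (forall k, k \in F -> measurable (B k)) ->
  measurable C ->
  forall k, k \in (i |` F)%fset -> measurable ([eta B with i |-> C] k).
Proof.
move=> mB mC k; rewrite !inE /=; case: eqP => //= _; exact: mB.
Qed.

Let probability_event_fsetU1 X F B i C : mutually_independent J X ->
  [set` (i |` F)%fset] `<=` J -> i \notin F ->
  (forall k, k \in F -> measurable (B k)) -> measurable C ->
  P (event X (i |` F)%fset [eta B with i |-> C]) =
  P (X i @^-1` C) * P (event X F B).
Proof.
move=> indep iFJ iF mB mC; have FJ : [set` F] `<=` J.
  by move=> k kF; apply: iFJ; rewrite /= !inE kF orbT.
rewrite indep//; last exact: measurable_with.
rewrite big_fsetU1//= eqxx indep//; congr (_ * _).
rewrite !big_seq; apply: eq_bigr => k kF; case: eqP => // ki.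
by rewrite -ki kF in iF.
Qed.

Let integral_prod_event X (s : seq I) F B : mutually_independent J X ->
  (forall i w, (0 <= X i w)%R) -> uniq s ->
  [set` s] `<=` J -> [set` F] `<=` J ->
  (forall i, i \in F -> measurable (B i)) ->
  (forall i, i \in s -> i \notin F) ->
  \int[P]_(w in event X F B) (\prod_(i <- s) X i w)%:E =
  (\prod_(i <- s) 'E_P[X i]) * P (event X F B).
Proof.
move=> indep X0; elim: s F B => [|i s IHs] F B.
  move=> _ _ _ mB _; under eq_integral do rewrite big_nil.
  by rewrite big_nil integral_cst//; exact: measurable_event.
move=> /= /andP[is_ us] sJ FJ mB sF.
have iF : i \notin F by apply: sF; rewrite mem_head.
have Ji : J i by apply: sJ; rewrite /= mem_head.
have {}sJ : [set` s] `<=` J by move=> k ks; apply: sJ; rewrite /= inE ks orbT.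
have {}sF k : k \in s -> k \notin F.
  by move=> ks; apply: sF; rewrite inE ks orbT.
have mD := measurable_event X mB; set D := event X F B in mD *.
pose S := (fun w => (\prod_(k <- s) X k w)%:E) \_ D.
have -> : \int[P]_(w in D) (\prod_(k <- i :: s) X k w)%:E =
    \int[P]_w (S w * (X i w)%:E).
  rewrite integral_mkcond; apply: eq_integral => w _.
  rewrite /S !patchE big_cons.
  by case: ifP => _; rewrite ?mul0e// -EFinM mulrC.
rewrite (@ge0_integral_mul_proportional _ _ _ P S (X i)
  (\prod_(k <- s) 'E_P[X k] * P D))//.
- by rewrite -expectation_def big_cons muleC muleA.
- apply/(measurable_restrictT _ _).1 => //.
  apply/measurable_EFinP/measurable_funTS.
  by apply: measurable_prod.
- by move=> w; rewrite /S patchE; case: ifP => // _; rewrite lee_fin prodr_ge0.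
- rewrite mule_ge0//; apply: prode_ge0 => k _; exact: expectation_ge0.
move=> r; have mr : measurable (`]r, +oo[ : set R) by [].
have iFJ : [set` (i |` F)%fset] `<=` J.
  by move=> k /=; rewrite !inE => /predU1P[->|/FJ].
rewrite /S -integral_mkcondr -event_fsetU1// IHs//.
- by rewrite probability_event_fsetU1// [X in _ * X = _]muleC muleA.
- exact: measurable_with.
- move=> k ks; rewrite !inE negb_or sF// andbT.
  by apply: contraNneq is_ => <-.
Qed.

Lemma expectation_prod X (s : seq I) : mutually_independent J X ->
  (forall i w, (0 <= X i w)%R) -> uniq s -> [set` s] `<=` J ->
  'E_P[fun w => (\prod_(i <- s) X i w)%R] = \prod_(i <- s) 'E_P[X i].
Proof.
move=> indep X0 us sJ.
have := @integral_prod_event X s fset0 (fun=> setT) indep X0 us sJ.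
have -> : event X fset0 (fun=> setT) = setT by apply/seteqP; split.
rewrite probability_setT mule1 => <- //.
by rewrite unlock.
Qed.

End IndependentProducts.

Section SubGaussian.
Context {R : realType} {d : measure_display} {T : measurableType d}.
Variable P : probability T R.
Implicit Types (X Y : T -> R) (c l v r y : R).

Lemma expR_le_invBl y : y < 1 -> expR y <= (1 - y)^-1.
Proof.
move=> y1; rewrite -[y]opprK expRN lef_pV2 ?posrE ?expR_gt0 ?opprK ?subr_gt0//.
exact: expR_ge1Dx.
Qed.

Lemma expR_le_add_expR_sqr y : expR y <= y + expR (2 * y ^+ 2).
Proof.
have quad := expR_ge1Dx (2 * y ^+ 2); have y2 := sqr_ge0 y.
have [y1|y1] := leP y 1; last first.
  have : expR y <= expR (2 * y ^+ 2) by rewrite ler_expR; nra.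
  by lra.
suff : expR y <= 1 + y + 2 * y ^+ 2 by lra.
have -> : expR y = expR (y / 2) ^+ 2 by rewrite -expRM_natl; congr expR; field.
have half_lt1 : 0 < 1 - y / 2 by lra.
apply: (@le_trans _ _ ((1 - y / 2) ^- 2)).
  rewrite -exprVn ler_sqr ?nnegrE ?expR_ge0 ?invr_ge0 ?(ltW half_lt1)//.
  by apply: expR_le_invBl; lra.
rewrite -[leLHS]mul1r ler_pdivrMr ?exprn_gt0//.
have -> : (1 + y + 2 * y ^+ 2) * (1 - y / 2) ^+ 2 =
  1 + y ^+ 2 / 2 * ((1 - y) * (5 / 2 - y)) by field.
rewrite lerDl; apply: mulr_ge0; first by rewrite divr_ge0 ?sqr_ge0.
by apply: mulr_ge0; lra.
Qed.

Local Open Scope ereal_scope.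

Lemma bounded_Lfun1 X c : measurable_fun setT X ->
  (forall w, `|X w| <= c)%R -> X \in Lfun P 1.
Proof.
move=> mX Xc; apply/Lfun1_integrable/measurable_bounded_integrable => //.
  exact: le_lt_trans (probability_le1 P measurableT) (ltry _).
exists c; split=> [|x cx w _ /=]; first exact: num_real.
by rewrite (le_trans (Xc w))// ltW.
Qed.

Lemma expectation_norm_le X c : measurable_fun setT X ->
  (forall w, `|X w| <= c)%R -> (`|fine 'E_P[X]| <= c)%R.
Proof.
move=> mX Xc; have XL := bounded_Lfun1 mX Xc.
rewrite -lee_fin -abse_EFin fineK ?expectation_fin_num// unlock.
apply: (le_trans (le_abse_integral _ _ _)) => //; first exact/measurable_EFinP.
rewrite -(expectation_cst P c) unlock; apply: ge0_le_integral => //.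
- by apply/measurable_EFinP; exact: measurableT_comp.
- exact/measurable_EFinP.
- by move=> w _; rewrite lee_fin.
Qed.

Lemma expectation_dist_le X Y c a :
  measurable_fun setT X -> measurable_fun setT Y ->
  (forall w, `|X w| <= a)%R -> (forall w, `|Y w| <= a)%R ->
  (forall w, `|X w - Y w| <= c)%R -> (`|fine 'E_P[X] - fine 'E_P[Y]| <= c)%R.
Proof.
move=> mX mY Xa Ya XYc.
have XL := bounded_Lfun1 mX Xa; have YL := bounded_Lfun1 mY Ya.
have -> : (fine 'E_P[X] - fine 'E_P[Y] = fine 'E_P[X \- Y])%R.
  by rewrite expectationB// fineB// expectation_fin_num.
by apply: expectation_norm_le => //; exact: measurable_funB.
Qed.

Lemma lee_prod (I : Type) (s : seq I) (f g : I -> \bar R) :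
  (forall i, 0 <= f i) -> (forall i, f i <= g i) ->
  \prod_(i <- s) f i <= \prod_(i <- s) g i.
Proof.
move=> f0 fg; elim: s => [|i s IHs]; first by rewrite !big_nil.
by rewrite !big_cons lee_pmul// prode_ge0.
Qed.

Lemma expectation_expR_le X c l : measurable_fun setT X ->
  (forall w, `|X w| <= c)%R -> 'E_P[X] = 0 ->
  'E_P[fun w => expR (l * X w)] <= (expR (2 * (l * c) ^+ 2))%:E.
Proof.
move=> mX Xc EX.
have mlX : measurable_fun setT (fun w => l * X w)%R by exact: measurable_funM.
have lXL : (fun w => l * X w)%R \in Lfun P 1.
  apply: (@bounded_Lfun1 _ (`|l| * c)%R) => // w.
  by rewrite normrM ler_wpM2l.
have cstL : (cst (expR (2 * (l * c) ^+ 2)) : T -> R) \in Lfun P 1.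
  exact: Lfun_cst.
have majorant w : (expR (l * X w) <= l * X w + expR (2 * (l * c) ^+ 2))%R.
  apply: (le_trans (expR_le_add_expR_sqr _)).
  rewrite lerD2l ler_expR ler_wpM2l//.
  rewrite -[leLHS]real_normK ?num_real// -[leRHS]real_normK ?num_real//.
  by rewrite ler_sqr ?nnegrE// !normrM ler_wpM2l// (le_trans (Xc w)) ?ler_norm.
have <- : 'E_P[(fun w => l * X w)%R \+ cst (expR (2 * (l * c) ^+ 2))] =
    (expR (2 * (l * c) ^+ 2))%:E.
  have scaleE : (fun w => l * X w)%R = l \o* X.
    by apply/funext => w; rewrite /= mulrC.
  rewrite expectationD// expectation_cst scaleE.
  by rewrite expectationZl ?(bounded_Lfun1 mX Xc)// EX mule0 add0e.
apply: expectation_le => //.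
- by apply: measurableT_comp.
- by apply: measurable_funD.
- by move=> w; apply: le_trans (majorant w); exact: expR_ge0.
- exact: aeW.
Qed.

Lemma measurable_set_ge X r :
  measurable_fun setT X -> measurable [set w | r <= X w]%R.
Proof.
move=> mX; have -> : [set w | r <= X w]%R = setT `&` X @^-1` `[r, +oo[.
  by rewrite setTI; apply/seteqP; split=> w /=; rewrite in_itv/= andbT.
exact: mX.
Qed.

Lemma subgaussian_upper_tail_le X v r : (0 < v)%R -> (0 <= r)%R ->
  measurable_fun setT X ->
  (forall l, 'E_P[fun w => expR (l * X w)] <= (expR (l ^+ 2 * v))%:E) ->
  P [set w | r <= X w]%R <= (expR (- (r ^+ 2 / (4 * v))))%:E.
Proof.
move=> v0; rewrite le_eqVlt => /predU1P[<-|r0] mX mgf.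
  rewrite expr0n/= mul0r oppr0 expR0.
  exact: probability_le1 (measurable_set_ge _ mX).
pose Z : {RV P >-> R} := HB.pack X (isMeasurableFun.Build _ _ _ _ X mX).
have l0 : (0 < r / (2 * v))%R by rewrite divr_gt0// mulr_gt0.
apply: (le_trans (chernoff Z r l0)).
have -> : 'M_P Z (r / (2 * v)) = 'E_P[fun w => expR (r / (2 * v) * X w)].
  by congr expectation; apply/funext => w; rewrite /= mulrC.
apply: (le_trans (lee_wpmul2r _ (mgf _))); first by rewrite lee_fin expR_ge0.
rewrite -EFinM -expRD lee_fin ler_expR le_eqVlt; apply/orP; left; apply/eqP.
by field; rewrite gt_eqF.
Qed.

Lemma subgaussian_tail_le X v r : (0 < v)%R -> (0 <= r)%R ->
  measurable_fun setT X ->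
  (forall l, 'E_P[fun w => expR (l * X w)] <= (expR (l ^+ 2 * v))%:E) ->
  P [set w | r <= `|X w|]%R <= (2 * expR (- (r ^+ 2 / (4 * v))))%:E.
Proof.
move=> v0 r0 mX mgf.
have mNX : measurable_fun setT (\- X)%R by exact: measurable_funN.
have -> : [set w | r <= `|X w|]%R =
    [set w | r <= X w]%R `|` [set w | r <= - X w]%R.
  by apply/seteqP; split=> w /=; rewrite ler_normr => /orP.
apply: (le_trans (measureU2 _ _ _)); [exact: measurable_set_ge..|].
rewrite mulr_natl mulr2n EFinD.
apply: leeD; apply: subgaussian_upper_tail_le => // l.
have -> : (fun w => expR (l * - X w))%R = (fun w => expR (- l * X w))%R.
  by apply/funext => w; rewrite mulrN mulNr.
by rewrite -(sqrrN l).
Qed.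

End SubGaussian.

Section Hoeffding.
Context {R : realType} {d : measure_display} {T : measurableType d}.
Variables (P : probability T R) (I : choiceType) (J : set I).
Variables (Y : I -> {RV P >-> R}) (c : R).
Hypotheses (indep : mutually_independent J Y) (c0 : 0 < c).
Hypothesis Yc : forall i w, `|Y i w| <= c.

Let EY i : R := fine 'E_P[Y i].

Let centered i w : R := Y i w - EY i.

Let measurable_centered i : measurable_fun setT (centered i).
Proof. exact: measurable_funB. Qed.

Let expectation_expR_centered_le i (l : R) :
  ('E_P[fun w => expR (l * centered i w)] <= (expR (8 * (l * c) ^+ 2))%:E)%E.
Proof.
have Y1 : (Y i : T -> R) \in Lfun P 1 by exact: bounded_Lfun1 (Yc i).
have -> : 8 * (l * c) ^+ 2 = 2 * (l * (2 * c)) ^+ 2 by ring.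
apply: expectation_expR_le => [|w|]; first exact: measurable_centered.
- apply: (le_trans (ler_normB _ _)); rewrite mulr_natl mulr2n lerD//.
  exact: expectation_norm_le.
- rewrite (@expectationB _ _ _ P (Y i) (cst (EY i))) ?Lfun_cst//.
  rewrite expectation_cst /EY fineK ?expectation_fin_num// subee//.
  exact: expectation_fin_num.
Qed.

Lemma hoeffding (s : seq I) (N : nat) (r : R) : uniq s -> [set` s] `<=` J ->
  (size s <= N)%N -> (0 < N)%N -> 0 <= r ->
  (P [set w | (r <= `|\sum_(i <- s) (Y i w - fine 'E_P[Y i])|)%R]
   <= (2 * expR (- (r ^+ 2 / (32 * c ^+ 2 * N%:R))))%:E)%E.
Proof.
move=> us sJ sN N0 r0; have NR : (0 : R) < N%:R by rewrite ltr0n.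
have -> : 32 * c ^+ 2 * N%:R = 4 * (8 * c ^+ 2 * N%:R) by ring.
apply: subgaussian_tail_le => // [||l]; first by rewrite !mulr_gt0 ?exprn_gt0.
  by apply: measurable_sum => i; exact: measurable_centered.
have mg i : measurable_fun setT (fun y : R => expR (l * (y - EY i))).
  apply: measurableT_comp => //; apply: measurable_funM => //.
  exact: measurable_funB.
pose g i : {mfun R >-> R} := HB.pack (fun y => expR (l * (y - EY i)))
  (isMeasurableFun.Build _ _ _ _ _ (mg i)).
have := expectation_prod (mutually_independent_comp g indep) _ us sJ.
have -> : (fun w => \prod_(i <- s) (g i \o Y i) w) =
    (fun w => expR (l * \sum_(i <- s) (Y i w - fine 'E_P[Y i]))).
  by apply/funext => w; rewrite mulr_sumr expR_sum.
move=> -> //; last by move=> i w; exact: expR_ge0.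
apply: (@le_trans _ _ (\prod_(i <- s) (expR (8 * (l * c) ^+ 2))%:E)%E).
  apply: lee_prod => i; first by apply: expectation_ge0 => w; exact: expR_ge0.
  exact: expectation_expR_centered_le.
rewrite prodEFin lee_fin big_const_seq count_predT iter_mulr_1 -expRM_natr.
rewrite ler_expR.
have -> : l ^+ 2 * (8 * c ^+ 2 * N%:R) = 8 * (l * c) ^+ 2 * N%:R by ring.
by rewrite ler_wpM2l ?ler_nat// mulr_ge0// sqr_ge0.
Qed.

End Hoeffding.

Section SqrtLog.
Context {R : realType}.
Implicit Types (x y t a b : R).

Lemma sqrtr_add_le a b : 0 <= a -> 0 <= b ->
  Num.sqrt (a + b) <= Num.sqrt a + Num.sqrt b.
Proof.
move=> a0 b0; rewrite -[leRHS]ger0_norm ?addr_ge0 ?sqrtr_ge0// -sqrtr_sqr.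
by rewrite ler_wsqrtr// sqrrD !sqr_sqrtr// addrAC lerDl mulrn_wge0.
Qed.

Lemma ln_le_powR y a : 0 < y -> 0 < a -> ln y <= y `^ a / a.
Proof.
move=> y0 a0; rewrite ler_pdivlMr// mulrC -ln_powR ltW// ln_sublinear//.
exact: powR_gt0.
Qed.

Lemma ln_natS_ge0 (n : nat) : 0 <= ln n.+1%:R :> R.
Proof. by rewrite ln_ge0// ler1n. Qed.

Definition sqrtlog x t : R :=
  Num.sqrt x * (Num.sqrt (ln (x + 1)) + Num.sqrt (ln (`|t| + 1))).

Lemma sqrtlog_ge0 x t : 0 <= sqrtlog x t.
Proof. by rewrite mulr_ge0 ?addr_ge0 ?sqrtr_ge0. Qed.

Lemma sqrtlogN x t : sqrtlog x (- t) = sqrtlog x t.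
Proof. by rewrite /sqrtlog normrN. Qed.

Lemma ln_le_sqrtr y : 0 < y -> ln y <= 2 * Num.sqrt y.
Proof.
move=> y0; have /(ln_le_powR y0) : (0 : R) < 2^-1 by [].
by rewrite invrK powR12_sqrt ?(ltW y0)// mulrC.
Qed.

Lemma sqrt_ln2_gt0 : 0 < Num.sqrt (ln 2) :> R.
Proof. by rewrite sqrtr_gt0 ln_gt0// ltr1n. Qed.

Lemma sqrtr_le_sqrtlog x t : 1 <= x ->
  Num.sqrt (ln 2) * Num.sqrt x <= sqrtlog x t.
Proof.
move=> x1; rewrite mulrC ler_wpM2l ?sqrtr_ge0// ler_wpDr ?sqrtr_ge0//.
by rewrite ler_wsqrtr// ler_ln ?posrE//; lra.
Qed.

Lemma sqrtr_ge1 x : 1 <= x -> 1 <= Num.sqrt x.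
Proof. by move=> x1; rewrite -[leLHS]sqrtr1 ler_wsqrtr. Qed.

Lemma sqrtlog_scale_le b : 0 < b -> exists2 C, 0 <= C &
  forall x y t, 1 <= x -> 0 <= y -> y <= b * x ->
  sqrtlog y t <= C * sqrtlog x t.
Proof.
move=> b0; pose c0 : R := Num.sqrt (ln 2); have c00 : 0 < c0 := sqrt_ln2_gt0.
pose C := Num.sqrt (ln (b + 1)) / c0 + 1.
have C1 : 1 <= C by rewrite lerDr divr_ge0 ?sqrtr_ge0// ltW.
exists (Num.sqrt b * C) => [|x y t x1 y0 yx].
  by rewrite mulr_ge0 ?sqrtr_ge0// (le_trans ler01).
have b1 : 0 < b + 1 by rewrite addr_gt0.
have lnx : 0 <= ln (x + 1) by rewrite ln_ge0//; lra.
have c0x : c0 <= Num.sqrt (ln (x + 1)).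
  by rewrite ler_wsqrtr// ler_ln ?posrE//; lra.
have sqrt_ln : Num.sqrt (ln (y + 1)) <= C * Num.sqrt (ln (x + 1)).
  apply: (@le_trans _ _ (Num.sqrt (ln (b + 1) + ln (x + 1)))).
    rewrite ler_wsqrtr// -lnM ?posrE//; last by lra.
    by rewrite ler_ln ?posrE; nra.
  apply: (le_trans (sqrtr_add_le _ _)) => //.
    by rewrite ln_ge0// lerDr ltW.
  rewrite mulrDl mul1r lerD2r -mulrA ler_peMr ?sqrtr_ge0//.
  by rewrite ler_pdivlMl// mulr1.
rewrite /sqrtlog mulrACA; apply: ler_pM; rewrite ?addr_ge0 ?sqrtr_ge0//.
  by rewrite -sqrtrM ?(ltW b0)// ler_wsqrtr.
by rewrite mulrDr lerD// ler_peMl ?sqrtr_ge0.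
Qed.

Lemma nneseries_inv_sqr_le (u : nat -> \bar R) (c : R) : 0 <= c ->
  (forall k, 0 <= u k)%E -> (forall k, u k <= (c * k.+1%:R ^- 2)%:E)%E ->
  (\sum_(k <oo) u k <= (2 * c)%:E)%E.
Proof.
move=> c0 u0 uc.
apply: lime_le; first by apply: is_cvg_nneseries => k _ _.
apply: nearW => m.
apply: (@le_trans _ _ (\sum_(0 <= k < m) (c * k.+1%:R ^- 2)%:E)%E).
  by apply: lee_sum => k _.
rewrite sumEFin lee_fin -mulr_sumr mulrC ler_wpM2r//.
apply: (@le_trans _ _ (\sum_(0 <= k < m) (- 2 / k.+2%:R - (- 2 / k.+1%:R)))).
  apply: ler_sum => k _.
  have k1 : (1 : R) <= k.+1%:R by rewrite ler1n.
  rewrite -[k.+2%:R]natr1; set x : R := k.+1%:R in k1 *.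
  have -> : - 2 / (x + 1) - (- 2 / x) = 2 * x / (x + 1) * x ^- 2.
    by field; rewrite !gt_eqF//; lra.
  by rewrite ler_peMl ?invr_ge0 ?sqr_ge0// ler_pdivlMr; lra.
rewrite (telescope_sumr (fun k => - 2 / k.+1%:R))// divr1 opprK.
by rewrite mulNr addrC gerBl divr_ge0.
Qed.

End SqrtLog.

Section RandomField.
Context {R : realType} {d : measure_display} {T : measurableType d}.
Variables (P : probability T R) (D : nat -> R -> T -> R) (v L M : R).
Implicit Types (t : R) (N m : nat) (w : T).
Hypotheses (v0 : 0 < v) (L0 : 0 <= L) (M0 : 0 <= M).
Hypothesis mD : forall N t, measurable_fun setT (D N t).
Hypothesis D_tail : forall N t r, (0 < N)%N -> 0 <= r ->
  (P [set w | r <= `|D N t w|]%R <= (2 * expR (- (r ^+ 2 / (v * N%:R))))%:E)%E.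
Hypothesis D_lipschitz : forall N t t' w, (0 < N)%N ->
  `|D N t w - D N t' w| <= L * (N%:R * Num.sqrt N%:R) * `|t - t'|.
Hypothesis D_bounded : forall N t w, `|D N t w| <= M * N%:R.

(* At this level the tail bound is 2 (N + 1) ^ (-2) (m + 1) ^ (-2). *)
Let level N m : R := Num.sqrt (2 * v * N%:R * (ln N.+1%:R + ln m.+1%:R)).

Let exceed N m : set T := [set w | level N m <= `|D N (m%:R / N%:R) w|].

Let measurable_exceed N m : measurable (exceed N m).
Proof. by apply: measurable_set_ge; exact: measurableT_comp. Qed.

Let exceed_le N m : (0 < N)%N ->
  (P (exceed N m) <= (2 * N.+1%:R ^- 2 * m.+1%:R ^- 2)%:E)%E.
Proof.
move=> N0; have NR : (0 : R) < N%:R by rewrite ltr0n.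
apply: (le_trans (D_tail _ N0 (sqrtr_ge0 _))).
rewrite sqr_sqrtr ?mulr_ge0 ?addr_ge0 ?ln_natS_ge0 ?(ltW v0)//.
have -> : 2 * v * N%:R * (ln N.+1%:R + ln m.+1%:R) / (v * N%:R) =
    2 * ln N.+1%:R + 2 * ln m.+1%:R by field; rewrite !gt_eqF.
have expR_ln k : expR (- (2 * ln k.+1%:R)) = k.+1%:R ^- 2 :> R.
  by rewrite expRN mulr_natl -lnXn ?ltr0n// lnK ?posrE ?exprn_gt0.
by rewrite opprD expRD !expR_ln mulrA.
Qed.

Let ae_grid : {ae P, forall w, exists k : nat, forall N m, (k < N)%N ->
  `|D N (m%:R / N%:R) w| <= level N m}.
Proof.
pose E k := \bigcup_m exceed k.+1 m.
have mE k : measurable (E k) by apply: bigcup_measurable => m _.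
have PE k : (P (E k) <= (4 * k.+1%:R ^- 2)%:E)%E.
  apply: (@le_trans _ _ (\sum_(m <oo) P (exceed k.+1 m))%E).
    exact: measure_sigma_subadditive.
  have -> : 4 * k.+1%:R ^- 2 = 2 * (2 * k.+1%:R ^- 2) :> R by ring.
  apply: nneseries_inv_sqr_le => [|//|m].
    by rewrite mulr_ge0 ?invr_ge0 ?sqr_ge0.
  apply: (le_trans (exceed_le _ _)) => //.
  rewrite lee_fin ler_wpM2r ?invr_ge0 ?sqr_ge0// ler_wpM2l//.
  by rewrite lef_pV2 ?posrE ?exprn_gt0// ler_sqr ?nnegrE// ler_nat.
exists (lim_sup_set E); split.
- by apply: bigcap_measurableType => k _; apply: bigcup_measurable => i _.
- apply: lim_sup_set_cvg0 => //; apply: le_lt_trans (ltry (2 * 4)).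
  exact: nneseries_inv_sqr_le.
- move=> w /= nw k _; apply: contrapT => nk; apply: nw; exists k => N m kN.
  have N0 : (0 < N)%N by exact: leq_trans kN.
  rewrite leNgt; apply/negP => exceed_N; apply: nk; exists N.-1.
    by rewrite /= -ltnS prednK.
  by exists m => //; rewrite /exceed/= prednK// ltW.
Qed.

Let level_le N m t : 0 <= t -> m%:R <= t * N%:R ->
  level N m <= 2 * Num.sqrt (2 * v) * sqrtlog N%:R t.
Proof.
move=> t0 mt; have t1 : 0 <= ln (t + 1) by rewrite ln_ge0// lerDr.
have N1 : 0 <= ln (N%:R + 1) :> R by rewrite natr1 ln_natS_ge0.
have lnm : ln m.+1%:R <= ln (N%:R + 1) + ln (t + 1).
  rewrite -lnM ?posrE ?ltr_wpDl// ler_ln ?posrE ?mulr_gt0 ?ltr_wpDl//.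
  rewrite -natr1; have := ler0n R N; lra.
have le_sqrt : Num.sqrt (ln N.+1%:R + ln m.+1%:R) <=
    2 * Num.sqrt (ln (N%:R + 1)) + Num.sqrt (ln (t + 1)).
  apply: (@le_trans _ _ (Num.sqrt
      (ln (N%:R + 1) + (ln (N%:R + 1) + ln (t + 1))))).
    by rewrite ler_wsqrtr// -natr1 lerD2l.
  rewrite mulr_natl mulr2n -addrA; apply: (le_trans (sqrtr_add_le _ _)).
  - by [].
  - exact: addr_ge0.
  - by rewrite lerD2l sqrtr_add_le.
rewrite /level sqrtrM ?mulr_ge0 ?(ltW v0)// sqrtrM ?mulr_ge0 ?(ltW v0)//.
rewrite /sqrtlog (ger0_norm t0) -!mulrA [leRHS]mulrCA ler_wpM2l ?sqrtr_ge0//.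
rewrite mulrCA ler_wpM2l ?sqrtr_ge0//; apply: (le_trans le_sqrt).
by rewrite mulrDr lerD2l ler_peMl ?sqrtr_ge0// ler1n.
Qed.

Let dist_grid_le N t : (0 < N)%N -> 0 <= t ->
  `|t - (Num.truncn (t * N%:R))%:R / N%:R| <= N%:R^-1.
Proof.
move=> N0 t0; have NR : (0 : R) < N%:R by rewrite ltr0n.
have /andP[ml mu] := truncn_itv (mulr_ge0 t0 (ltW NR)).
rewrite ger0_norm ?subr_ge0 ?ler_pdivrMr// lerBlDr -{1}[N%:R^-1]mul1r -mulrDl.
by rewrite ler_pdivlMr// addrC natr1 ltW.
Qed.

Lemma ae_sqrtlog_bound_ge0 : {ae P, forall w, exists2 C : R, 0 <= C &
  forall N t, (0 < N)%N -> 0 <= t -> `|D N t w| <= C * sqrtlog N%:R t}.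
Proof.
apply: filterS ae_grid => w [k kP].
pose c0 : R := Num.sqrt (ln 2); have c00 : 0 < c0 := sqrt_ln2_gt0.
pose C1 := M * k%:R / c0; pose C2 := 2 * Num.sqrt (2 * v); pose C3 := L / c0.
have C10 : 0 <= C1 by rewrite divr_ge0 ?mulr_ge0// ltW.
have C20 : 0 <= C2 by rewrite mulr_ge0 ?sqrtr_ge0.
have C30 : 0 <= C3 by rewrite divr_ge0// ltW.
exists (C1 + C2 + C3) => [|N t N0 t0]; first by rewrite !addr_ge0.
have NR : (0 : R) < N%:R by rewrite ltr0n.
have N1 : (1 : R) <= N%:R by rewrite ler1n.
have sqrt_le := sqrtr_le_sqrtlog t N1; have := sqrtlog_ge0 N%:R t.
rewrite -/c0 in sqrt_le; set rt := sqrtlog _ _ in sqrt_le *.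
have [Nk|kN] := leqP N k => rt0.
  have c0_rt : c0 <= rt.
    by apply: le_trans sqrt_le; rewrite ler_peMr ?(ltW c00) ?sqrtr_ge1.
  apply: (le_trans (D_bounded _ _ _)); apply: (@le_trans _ _ (C1 * rt)).
    apply: (@le_trans _ _ (C1 * c0)); last by rewrite ler_wpM2l.
    by rewrite divfK ?gt_eqF// ler_wpM2l// ler_nat.
  by rewrite ler_wpM2r//; lra.
pose m := Num.truncn (t * N%:R).
have mt : m%:R <= t * N%:R by rewrite truncn_le mulr_ge0// ltW.
have grid : `|D N (m%:R / N%:R) w| <= C2 * rt.
  exact: le_trans (kP N m kN) (level_le t0 mt).
have lip : `|D N t w - D N (m%:R / N%:R) w| <= C3 * rt.
  apply: (le_trans (D_lipschitz _ _ _ N0)).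
  apply: (@le_trans _ _ (L * (N%:R * Num.sqrt N%:R) * N%:R^-1)).
    by rewrite ler_wpM2l ?dist_grid_le// !mulr_ge0 ?sqrtr_ge0.
  have -> : L * (N%:R * Num.sqrt N%:R) * N%:R^-1 = C3 * (c0 * Num.sqrt N%:R).
    by rewrite /C3; field; rewrite !gt_eqF.
  by rewrite ler_wpM2l.
rewrite -(subrK (D N (m%:R / N%:R) w) (D N t w)).
apply: (le_trans (ler_normD _ _)).
have := mulr_ge0 C10 rt0; lra.
Qed.

End RandomField.

Lemma ae_sqrtlog_bound {R : realType} {d : measure_display}
    {T : measurableType d} (P : probability T R) (D : nat -> R -> T -> R)
    (v L M : R) :
  0 < v -> 0 <= L -> 0 <= M ->
  (forall N t, measurable_fun setT (D N t)) ->
  (forall N t r, (0 < N)%N -> 0 <= r ->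
    (P [set w | r <= `|D N t w|]%R
     <= (2 * expR (- (r ^+ 2 / (v * N%:R))))%:E)%E) ->
  (forall N t t' w, (0 < N)%N ->
    `|D N t w - D N t' w| <= L * (N%:R * Num.sqrt N%:R) * `|t - t'|) ->
  (forall N t w, `|D N t w| <= M * N%:R) ->
  {ae P, forall w, exists2 C : R, 0 <= C &
    forall N t, (0 < N)%N -> `|D N t w| <= C * sqrtlog N%:R t}.
Proof.
move=> v0 L0 M0 mD tail lip bnd.
have lipN N t t' w : (0 < N)%N ->
    `|D N (- t) w - D N (- t') w| <= L * (N%:R * Num.sqrt N%:R) * `|t - t'|.
  by move=> N0; rewrite (le_trans (lip N _ _ w N0))// opprK addrC distrC.
have nonneg := ae_sqrtlog_bound_ge0 v0 L0 M0 mD tail lip bnd.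
have nonpos := @ae_sqrtlog_bound_ge0 _ _ _ P (fun N t => D N (- t)) _ _ _
  v0 L0 M0 (fun N t => mD N _) (fun N t => tail N _) lipN (fun N t => bnd N _).
apply: filterS2 nonneg nonpos => w [C1 C10 le1] [C2 C20 le2].
exists (C1 + C2) => [|N t N0]; first exact: addr_ge0.
rewrite mulrDl; have r0 := sqrtlog_ge0 N%:R t; have [t0|t0] := leP 0 t.
  by rewrite (le_trans (le1 N t N0 t0))// lerDl mulr_ge0.
have := le2 N (- t) N0; rewrite opprK sqrtlogN oppr_ge0 => /(_ (ltW t0)).
move=> /le_trans; apply.
by rewrite lerDr mulr_ge0.
Qed.

Section OscillatingSums.
Context {R : realType} {d : measure_display} {T : measurableType d}.
Variables (P : probability T R) (X : nat -> {RV P >-> R}) (a : nat) (c : R).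
Implicit Types (N j : nat) (t phi : R) (w : T).

Definition osc_deviation phi N t w : R :=
  \sum_(a <= j < N.+1) (osc t phi (X j w) - fine 'E_P[osc t phi \o X j]).

Hypotheses (a0 : (0 < a)%N) (c0 : 0 < c).
Hypothesis Xc : forall j w, (a <= j)%N -> 1 <= X j w <= c * j%:R.
Hypothesis indep : mutually_independent [set j | (a <= j)%N] X.

Let measurable_osc_comp t phi j : measurable_fun setT (osc t phi \o X j).
Proof. exact: measurable_funPT. Qed.

Let osc_comp_le t phi j w : `|(osc t phi \o X j) w| <= 1.
Proof. exact: osc_norm_le. Qed.

Let size_le N : (N.+1 - a <= N)%N.
Proof. by rewrite leq_subLR -add1n leq_add2r. Qed.

Let osc_deviation_sum_le (f : nat -> R) (b : R) N : 0 <= b ->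
  (forall j, (a <= j < N.+1)%N -> `|f j| <= b) ->
  `|\sum_(a <= j < N.+1) f j| <= b * N%:R.
Proof.
move=> b0 fb; apply: (le_trans (norm_sum_nat_le fb)).
by rewrite -[leLHS]mulr_natr ler_wpM2l// ler_nat.
Qed.

Lemma osc_deviation_norm_le phi N t w : `|osc_deviation phi N t w| <= 2 * N%:R.
Proof.
apply: osc_deviation_sum_le => // j _; apply: (le_trans (ler_normB _ _)).
rewrite [2]mulr2n lerD//; first exact: osc_norm_le.
exact: expectation_norm_le.
Qed.

Lemma osc_deviation_dist_le phi N t t' w : (0 < N)%N ->
  `|osc_deviation phi N t w - osc_deviation phi N t' w|
  <= 4 * Num.sqrt c * (N%:R * Num.sqrt N%:R) * `|t - t'|.
Proof.
move=> N0; pose b := 2 * Num.sqrt c * Num.sqrt N%:R * `|t - t'|.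
have b0 : 0 <= b by rewrite !mulr_ge0 ?sqrtr_ge0.
have osc_b j w' : (a <= j < N.+1)%N ->
    `|osc t phi (X j w') - osc t' phi (X j w')| <= b.
  move=> /andP[aj jN]; have /andP[X1 Xj] := Xc w' aj.
  apply: (le_trans (osc_dist_le _ _ _ X1)); rewrite mulrC ler_wpM2r//.
  apply: (le_trans (ln_le_sqrtr (lt_le_trans ltr01 X1))).
  rewrite -mulrA ler_wpM2l// -sqrtrM ?(ltW c0)// ler_wsqrtr// (le_trans Xj)//.
  by rewrite ler_wpM2l ?(ltW c0)// ler_nat.
have -> : 4 * Num.sqrt c * (N%:R * Num.sqrt N%:R) * `|t - t'| = 2 * b * N%:R.
  by rewrite /b; ring.
rewrite /osc_deviation -sumrB; apply: osc_deviation_sum_le => [|j jN].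
  by rewrite mulr_ge0.
rewrite opprD addrACA -opprD; apply: (le_trans (ler_normB _ _)).
rewrite mulr_natl mulr2n lerD//; first exact: osc_b.
apply: (@expectation_dist_le _ _ _ P _ _ _ 1) => // w'; exact: osc_b.
Qed.

Lemma measurable_osc_deviation phi N t :
  measurable_fun setT (osc_deviation phi N t).
Proof.
apply: measurable_sum => j; apply: measurable_funB => //.
exact: measurable_osc_comp t phi j.
Qed.

Lemma osc_deviation_tail_le phi N t r : (0 < N)%N -> 0 <= r ->
  (P [set w | r <= `|osc_deviation phi N t w|]%R
   <= (2 * expR (- (r ^+ 2 / (32 * N%:R))))%:E)%E.
Proof.
move=> N0 r0; have -> : 32 * N%:R = 32 * 1 ^+ 2 * N%:R :> R by ring.
apply: (hoeffding (mutually_independent_comp (fun=> osc t phi) indep)) => //.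
- by move=> j w; exact: osc_norm_le.
- exact: iota_uniq.
- by move=> j /=; rewrite mem_index_iota => /andP[].
- by rewrite size_iota.
Qed.

Lemma ae_osc_deviation_le phi : {ae P, forall w, exists2 C : R, 0 <= C &
  forall N t, `|osc_deviation phi N t w| <= C * sqrtlog N%:R t}.
Proof.
have sqrtc : 0 <= 4 * Num.sqrt c by rewrite mulr_ge0 ?sqrtr_ge0.
apply: filterS (ae_sqrtlog_bound (v := 32) (M := 2) _ sqrtc _
  (measurable_osc_deviation phi) (@osc_deviation_tail_le phi)
  (osc_deviation_dist_le phi) (osc_deviation_norm_le phi)) => // w [C C0 CP].
exists C => // N t; have [->|N0] := posnP N; last exact: CP.
by rewrite /osc_deviation big_geq// normr0 mulr_ge0 ?sqrtlog_ge0.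
Qed.

End OscillatingSums.

Section UniformMean.
Context {R : realType} {d : measure_display} {T : measurableType d}.
Implicit Types (F f : R -> R) (a b c : R).

Lemma integral_is_derive F f a b : a < b ->
  (forall x, a <= x <= b -> is_derive x 1 F (f x)) ->
  (forall x, a <= x <= b -> {for x, continuous f}) ->
  (\int[@lebesgue_measure R]_(x in `[a, b]) (f x)%:E = (F b - F a)%:E)%E.
Proof.
move=> ab dF cf.
have cF x : a <= x <= b -> {for x, continuous F}.
  move=> xab; apply/differentiable_continuous/derivable1_diffP.
  exact: (@ex_derive _ _ _ _ _ _ _ (dF x xab)).
rewrite EFinB; apply: continuous_FTC2 => //.
- apply: continuous_in_subspaceT => x; rewrite inE/= in_itv/= => xab.
  exact: cf.
- split.
  + move=> x; rewrite in_itv/= => /andP[ax xb].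
    by apply: ex_derive; apply: dF; rewrite !ltW.
  + by apply: cvg_at_right_filter; apply: cF; rewrite lexx ltW.
  + by apply: cvg_at_left_filter; apply: cF; rewrite lexx ltW.
- move=> x; rewrite in_itv/= => /andP[ax xb]; rewrite derive1E.
  by apply: derive_val; apply: dF; rewrite !ltW.
Qed.

Lemma ge0_expectation_uniform (P : probability T R) (X : {RV P >-> R}) a b
    (ab : a < b) (f : {mfun R >-> R}) F : uniformly_selected X ab ->
  (forall u, 0 <= f u) ->
  (forall u, a <= u <= b -> is_derive u 1 F (f u)) ->
  (forall u, a <= u <= b -> {for u, continuous f}) ->
  ('E_P[f \o X] = ((F b - F a) / (b - a))%:E)%E.
Proof.
move=> [_ uX] f0 dF cf.
have mf : measurable_fun [set: R] (EFin \o f) by exact/measurable_EFinP.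
(* [uniform_prob] lives on [measurableTypeR R], whose display differs from the
   one of the codomain of [X]. *)
have mX : measurable_fun [set: T] (X : T -> measurableTypeR R).
  by move=> mT B mB; exact: (@measurable_funPT _ _ _ _ X mT B mB).
pose X' : {mfun T >-> measurableTypeR R} :=
  HB.pack (X : T -> measurableTypeR R) (isMeasurableFun.Build _ _ _ _ _ mX).
rewrite unlock; transitivity (\int[distribution P X']_y (f y)%:E)%E.
  by rewrite (@ge0_integral_distribution _ _ _ (measurableTypeR R)).
transitivity (\int[uniform_prob ab]_y (f y)%:E)%E.
  by apply: eq_measure_integral => B mB _; exact: uX.
rewrite integral_uniform//.
by rewrite (integral_is_derive ab dF cf) -EFinM mulrC.
Qed.

Lemma expectation_uniform (P : probability T R) (X : {RV P >-> R}) a b c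
    (ab : a < b) (f : {mfun R >-> R}) F : uniformly_selected X ab ->
  (forall u, `|f u| <= c) ->
  (forall u, a <= u <= b -> is_derive u 1 F (f u)) ->
  (forall u, a <= u <= b -> {for u, continuous f}) ->
  'E_P[f \o X]%E = ((F b - F a) / (b - a))%:E.
Proof.
move=> uX fc dF cf.
have mfc : measurable_fun setT (fun u => f u + c) by exact: measurable_funD.
pose g : {mfun R >-> R} :=
  HB.pack (fun u => f u + c) (isMeasurableFun.Build _ _ _ _ _ mfc).
have Eg : 'E_P[g \o X]%E = ((F b + c * b - (F a + c * a)) / (b - a))%:E.
  apply: (@ge0_expectation_uniform _ _ _ _ _ g (fun u => F u + c * u) uX).
  - by move=> u; have := fc u; rewrite ler_norml /= => /andP[]; lra.
  - move=> u uab; have dFu := dF u uab.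
    by apply: is_derive_eq; rewrite /GRing.scale/= mulr1.
  - by move=> u uab; apply: continuousD; [exact: cf|exact: cvg_cst].
have fL : f \o X \in Lfun P 1.
  by apply: (@bounded_Lfun1 _ _ _ _ _ c) => // w; exact: fc.
have {Eg} : ('E_P[f \o X] + c%:E)%E = ((F b - F a) / (b - a) + c)%:E.
  rewrite -(expectation_cst P c) -expectationD ?Lfun_cst//.
  rewrite -[LHS]/('E_P[g \o X])%E Eg; congr EFin; field.
  by rewrite gt_eqF// subr_gt0.
by move=> /(congr1 (fun x => x - c%:E)%E); rewrite EFinD !addeK.
Qed.

End UniformMean.

Section SelectedSequence.
Context {R : realType} {d : measure_display} {T : measurableType d}.
Variable P : probability T R.
Variables A K theta : R.
Hypotheses (A0 : 0 < A) (K0 : 0 < K) (theta0 : 0 < theta) (theta1 : theta < 1).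
Variable n : nat -> {RV P >-> R}.
Hypothesis n_unif : forall (j : nat) (j0 : (0 < j)%N),
  uniformly_selected (n j) (sel_lt theta A0 K0 j0).
Hypothesis n_indep : mutually_independent [set j : nat | (0 < j)%N] n.
Implicit Types (t x phi : R) (w : T) (j : nat).

Local Notation start := (window_start A K theta).

Lemma in_windows_selected w : in_windows A K theta (fun j => n j w).
Proof. by move=> j j0; have [/(_ w)] := n_unif j0; rewrite /= in_itv. Qed.

Let start_gt0 j : (start <= j)%N -> (0 < j)%N.
Proof. exact: leq_trans. Qed.

Lemma sel_lo_start j : (start <= j)%N ->
  sel_lo A K theta j = window_lo A K theta j%:R.
Proof.
move=> sj; apply/max_idPr.
by rewrite (le_trans ler01)// window_lo_ge1// ler_nat.
Qed.

Lemma selected_le j w : (start <= j)%N -> 1 <= n j w <= 2 / A * j%:R.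
Proof.
move=> sj; have jl : start%:R <= j%:R :> R by rewrite ler_nat.
have /andP[nl nh] := in_windows_selected w (start_gt0 sj).
rewrite (le_trans nh (window_hi_le A0 K0 theta1 jl)) andbT.
by rewrite (le_trans (window_lo_ge1 A0 K0 theta1 jl))// -sel_lo_start// ltW.
Qed.

Lemma expectation_osc_selected t phi j : (start <= j)%N ->
  'E_P[osc t phi \o n j]%E = (secant A K theta (osc_prim t phi) j%:R)%:E.
Proof.
move=> sj; have jl : start%:R <= j%:R :> R by rewrite ler_nat.
have lo0 : 0 < sel_lo A K theta j.
  by rewrite sel_lo_start// (lt_le_trans ltr01)// window_lo_ge1.
have dF u : sel_lo A K theta j <= u <= sel_hi A K theta j ->
    is_derive u 1 (osc_prim t phi) (osc t phi u).
  by move=> /andP[lu _]; exact/is_derive_osc_prim/(lt_le_trans lo0).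
have cf u : sel_lo A K theta j <= u <= sel_hi A K theta j ->
    {for u, continuous (osc t phi)}.
  by move=> /andP[lu _]; exact/continuous_osc/(lt_le_trans lo0).
rewrite (expectation_uniform (n_unif (start_gt0 sj)) (osc_norm_le t phi) dF cf).
rewrite sel_lo_start// -[sel_hi A K theta j]/(window_hi A K theta j%:R).
by rewrite window_hi_sub_lo.
Qed.

Definition error_term x t : R := sqrtlog x t + x `^ theta + x `^ (1 - theta).

Lemma ae_fsum_osc_dist_le phi : {ae P, forall w, exists2 C : R, 0 <= C &
  forall x t, 1 <= x ->
  `|\sum_(j \in indices_le (fun j => n j w) x) osc t phi (n j w)
    - A * osc_prim t phi x| <= C * error_term x t}.
Proof.
have [C1 C10 near] := in_windows_fsum_dist A0 K0 theta0 theta1.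
have [C2 C20 mean] := sum_secant_dist_le A0 K0 theta0 theta1.
have [C3 C30 sqrtlogA] := sqrtlog_scale_le A0.
have n_indep_start : mutually_independent [set j | (start <= j)%N] n.
  by apply: mutually_independentS n_indep => j; exact: start_gt0.
have A2 : 0 < 2 / A by rewrite divr_gt0.
have start0 : (0 < start)%N by [].
have dev_ae := ae_osc_deviation_le start0 A2 (fun j w => @selected_le j w)
  n_indep_start phi.
apply: filterS dev_ae => w [C4 C40 dev]; have C430 := mulr_ge0 C40 C30.
have s0 : (0 : R) <= start%:R by [].
exists (C1 + start%:R + C4 * C3 + C2) => [|x t x1]; first by lra.
have Ax : 0 <= A * x by rewrite mulr_ge0 ?(ltW A0)// (le_trans ler01).
pose f j := osc t phi (n j w); pose J := Num.truncn (A * x).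
have f1 j : (0 < j)%N -> `|f j| <= 1 by move=> _; exact: osc_norm_le.
pose mean_sum :=
  \sum_(start <= j < J.+1) secant A K theta (osc_prim t phi) j%:R.
have [_ /(_ f f1) indices_sum] := near _ x (in_windows_selected w) x1.
have start_sum := @sum_nat_start_dist_le _ f start J.+1 start0 f1.
have dev_sum : `|\sum_(start <= j < J.+1) f j - mean_sum|
    <= C4 * (C3 * sqrtlog x t).
  have -> : \sum_(start <= j < J.+1) f j - mean_sum =
      osc_deviation n start phi J t w.
    rewrite /osc_deviation -sumrB; apply: eq_big_nat => j /andP[sj _].
    by rewrite expectation_osc_selected.
  by apply: (le_trans (dev _ _)); rewrite ler_wpM2l// sqrtlogA// truncn_le.
have mean_dist := mean _ _ _ x (unit_primitives_osc t phi) x1.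
have p1 : 1 <= x `^ theta by rewrite powR_ge1// ltW.
have q0 : 0 <= x `^ (1 - theta) by exact: powR_ge0.
have r0 := sqrtlog_ge0 x t.
set S := \sum_(j \in _) _ in indices_sum *.
have -> : S - A * osc_prim t phi x =
    (S - \sum_(1 <= j < J.+1) f j)
    + (\sum_(1 <= j < J.+1) f j - \sum_(start <= j < J.+1) f j)
    + (\sum_(start <= j < J.+1) f j - mean_sum)
    + (mean_sum - A * osc_prim t phi x) by ring.
apply: (@le_trans _ _ (C1 * x `^ theta + start%:R + C4 * (C3 * sqrtlog x t)
    + C2 * (x `^ theta + x `^ (1 - theta)))).
  do 3 (apply: (le_trans (ler_normD _ _)); apply: lerD => //).
rewrite /error_term; nra.
Qed.

End SelectedSequence.

Section PowerSums.
Context {R : realType}.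
Implicit Types (s : nat -> R) (A a b t u x y : R) (z : R[i]).

Lemma normc_le_Re_Im z : Normc.normc z <= `|complex.Re z| + `|complex.Im z|.
Proof.
case: z => p q /=; apply: (le_trans (sqrtr_add_le (sqr_ge0 p) (sqr_ge0 q))).
by rewrite !sqrtr_sqr.
Qed.

Lemma normc_cpowR u z : Normc.normc (cpowR u z) = expR (complex.Re z * ln u).
Proof.
rewrite /cpowR Normc.normcM /= cos2Dsin2 sqrtr1 mulr1 expr0n addr0 sqrtr_sqr.
by rewrite ger0_norm ?expR_ge0.
Qed.

Lemma Re_cpowR t u : complex.Re (cpowR u (0 -i* t)) = osc t 0 u.
Proof.
by rewrite /cpowR /osc/= mul0r expR0 mul1r mul0r subr0 addr0 mulNr cosN.
Qed.

Lemma Im_cpowR t u : complex.Im (cpowR u (0 -i* t)) = osc t (pi / 2) u.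
Proof.
by rewrite /cpowR /osc/= mul0r expR0 mul1r mul0r addr0 mulNr sinN cosDpihalf.
Qed.

Lemma Re_power_sum s x t : finite_set (indices_le s x) ->
  complex.Re (power_sum s x t) = \sum_(j \in indices_le s x) osc t 0 (s j).
Proof.
move=> fin; rewrite /power_sum !fsbig_finite// (raddf_sum (@complex.Re R)).
by apply: eq_bigr => j _; exact: Re_cpowR.
Qed.

Lemma Im_power_sum s x t : finite_set (indices_le s x) ->
  complex.Im (power_sum s x t)
  = \sum_(j \in indices_le s x) osc t (pi / 2) (s j).
Proof.
move=> fin; rewrite /power_sum !fsbig_finite// (raddf_sum (@complex.Im R)).
by apply: eq_bigr => j _; exact: Im_cpowR.
Qed.

Lemma normc_power_sum_le s x t : finite_set (indices_le s x) ->
  Normc.normc (power_sum s x t) <= (counting_fun s x)%:R.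
Proof.
move=> fin; rewrite counting_funE// /power_sum !fsbig_finite//.
apply: (big_ind2 (fun z r => Normc.normc z <= r)) => [|z p z' q zp zq|j _].
- by rewrite Normc.normc0.
- by apply: (le_trans (le_normcD _ _)); exact: lerD.
- by rewrite normc_cpowR mul0r expR0.
Qed.

Lemma counting_fun_le s x y : finite_set (indices_le s y) -> x <= y ->
  finite_set (indices_le s x) /\ (counting_fun s x <= counting_fun s y)%N.
Proof.
move=> fin xy; have sub : indices_le s x `<=` indices_le s y.
  by move=> j [j0 sx]; split=> //; exact: le_trans xy.
have fin_x := sub_finite_set sub fin; split=> //.
by apply/fsubset_leq_card; rewrite -fset_set_sub.
Qed.

Definition main_term A x t : R[i] := A%:C * cpowR x (1 -i* t) / (1 -i* t).

Lemma main_termE A x t : 0 < x ->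
  main_term A x t = (A * osc_prim t 0 x) +i* (A * osc_prim t (pi / 2) x).
Proof.
move=> x0; have t0 : 1 + t ^+ 2 != 0 by rewrite addr_sqr_neq0.
have it0 : (1 -i* t : R[i]) != 0 by rewrite eq_complex/= oner_eq0.
apply: (mulIf it0).
rewrite divfK// /cpowR /osc_prim mulNr cosN sinN mul1r lnK//.
rewrite addr0 cosDpihalf sinDpihalf; set p := cos _; set q := sin _.
by apply/eqP; rewrite eq_complex/=; apply/andP; split; apply/eqP; field.
Qed.

Lemma normc_main_term_le A x t : 0 <= A -> 0 < x ->
  Normc.normc (main_term A x t) <= A * x.
Proof.
move=> A0 x0; rewrite /main_term Normc.normcM Normc.normcM normc_cpowR.
rewrite Normc.normcV/= mul1r lnK// expr0n addr0 sqrtr_sqr (ger0_norm A0).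
rewrite expr1n sqrrN.
have norm1it : 1 <= Num.sqrt (1 + t ^+ 2) by rewrite sqrtr_ge1// lerDl sqr_ge0.
by rewrite ler_pdivrMr ?(lt_le_trans ltr01)// ler_peMr// mulr_ge0// ltW.
Qed.

Lemma normc_power_sum_main_term_bounded s A x y t :
  0 <= A -> 0 < x -> x <= y -> finite_set (indices_le s y) ->
  Normc.normc (power_sum s x t - main_term A x t)
  <= (counting_fun s y)%:R + A * y.
Proof.
move=> A0 x0 xy fin; have [fin_x count_le] := counting_fun_le fin xy.
apply: (le_trans (le_normcD _ _)); rewrite normcN; apply: lerD.
  by rewrite (le_trans (normc_power_sum_le t fin_x))// ler_nat.
by rewrite (le_trans (normc_main_term_le t A0 x0))// ler_wpM2l.
Qed.

Lemma normc_power_sum_main_term_le s A x t (e1 e2 : R) :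
  0 < x -> finite_set (indices_le s x) ->
  `|\sum_(j \in indices_le s x) osc t 0 (s j) - A * osc_prim t 0 x| <= e1 ->
  `|\sum_(j \in indices_le s x) osc t (pi / 2) (s j)
    - A * osc_prim t (pi / 2) x| <= e2 ->
  Normc.normc (power_sum s x t - main_term A x t) <= e1 + e2.
Proof.
move=> x0 fin re im; apply: (le_trans (normc_le_Re_Im _)).
by rewrite main_termE// !raddfB/= Re_power_sum// Im_power_sum// lerD.
Qed.

Lemma Rintegral_osc A a b t phi : 0 < a -> a <= b ->
  Rintegral (@lebesgue_measure R) `[a, b] (fun u => osc t phi u * A)
  = A * osc_prim t phi b - A * osc_prim t phi a.
Proof.
move=> a0; rewrite le_eqVlt => /predU1P[<-|ab].
  by rewrite subrr set_itv1 Rintegral_set1.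
rewrite /Rintegral.
have -> // : (\int[@lebesgue_measure R]_(u in `[a, b]) (osc t phi u * A)%:E)%E =
  (A * osc_prim t phi b - A * osc_prim t phi a)%:E.
apply: (@integral_is_derive _ (fun u => A * osc_prim t phi u)) => //;
  move=> u /andP[au _].
- have du := is_derive_osc_prim t phi (lt_le_trans a0 au).
  by rewrite mulrC; exact: is_deriveZ.
- apply: continuousM; last exact: cvg_cst.
  exact/continuous_osc/(lt_le_trans a0).
Qed.

Lemma Cintegral_cpowR A a b t : 0 < a -> a <= b ->
  Cintegral a b (fun u => cpowR u (0 -i* t) * (derive1 (fun x => A * x) u)%:C)
  = main_term A b t - main_term A a t.
Proof.
move=> a0 ab; have dA u : derive1 (fun x : R => A * x) u = A.
  by rewrite derive1E deriveZ//= derive_id [LHS]mulr1.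
rewrite !main_termE ?(lt_le_trans a0)// /Cintegral -[RHS]/(_ +i* _).
rewrite -!Rintegral_osc//.
congr (_ +i* _); congr (Rintegral _ _ _); apply/funext => u; rewrite dA.
- by rewrite -Re_cpowR; case: (cpowR _ _) => p q /=; rewrite mulr0 subr0.
- by rewrite -Im_cpowR; case: (cpowR _ _) => p q /=; rewrite mulr0 add0r.
Qed.

End PowerSums.

Section PolynomialHeights.
Context {R : realType}.
Implicit Types (s : nat -> R) (A B a eps t x y : R).

Lemma powR_div_le B eps y t : 0 < B -> 0 < eps -> 0 <= y -> 0 <= t ->
  y <= t `^ B -> y `^ (eps / B) <= t `^ eps.
Proof.
move=> B0 eps0 y0 t0 yt; have -> : t `^ eps = (t `^ B) `^ (eps / B).
  by rewrite -powRrM mulrCA mulfV ?gt_eqF// mulr1.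
by rewrite le_powR2r// ltW// divr_gt0.
Qed.

Lemma sqrt_ln_le_powR y a : 0 < y -> 0 < a ->
  Num.sqrt (ln y) <= (Num.sqrt (2 * a))^-1 * y `^ a.
Proof.
move=> y0 a0; have a2 : 0 < 2 * a by rewrite mulr_gt0.
apply: (@le_trans _ _ (Num.sqrt (y `^ (2 * a) / (2 * a)))).
  by rewrite ler_wsqrtr// ln_le_powR.
have -> : y `^ (2 * a) = (y `^ a) ^+ 2.
  by rewrite mulrC powRrM powR_mulrn ?powR_ge0.
rewrite sqrtrM ?sqr_ge0// sqrtr_sqr ger0_norm ?powR_ge0//.
by rewrite sqrtrV ?(ltW a2)// mulrC.
Qed.

Lemma powR_ge1_inv t B : 0 < B -> 0 <= t -> 1 <= t `^ B -> 1 <= t.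
Proof.
move=> B0 t0; apply: contraTT; rewrite -!ltNge => t1.
have <- : 1 `^ B = 1 :> R by rewrite powR1.
by apply: gt0_ltr_powR; rewrite ?nnegrE.
Qed.

Lemma sqrtlog_le_powR B eps : 0 < B -> 0 < eps -> exists2 C : R, 0 <= C &
  forall x t, 1 <= x -> x <= `|t| `^ B ->
  sqrtlog x t <= C * (Num.sqrt x * `|t| `^ eps).
Proof.
move=> B0 eps0; have eB0 : 0 < eps / B by rewrite divr_gt0.
pose C a : R := (Num.sqrt (2 * a))^-1 * 2 `^ a.
have C0 a : 0 <= C a by rewrite mulr_ge0 ?invr_ge0 ?sqrtr_ge0 ?powR_ge0.
have sqrt_ln_succ_le a y z : 0 < a -> 1 <= y -> y `^ a <= z ->
    Num.sqrt (ln (y + 1)) <= C a * z.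
  move=> a0 y1 yz; apply: (le_trans (sqrt_ln_le_powR _ a0)); first by lra.
  rewrite -mulrA ler_wpM2l ?invr_ge0 ?sqrtr_ge0//.
  apply: (@le_trans _ _ ((2 * y) `^ a)).
    by rewrite le_powR2r ?(ltW a0)//; lra.
  by rewrite powRM ?(le_trans ler01 y1)// ler_wpM2l ?powR_ge0.
exists (C (eps / B) + C eps) => [|x t x1 xt]; first exact: addr_ge0.
have t1 : 1 <= `|t| by apply: (powR_ge1_inv B0) => //; exact: le_trans xt.
rewrite mulrCA ler_wpM2l ?sqrtr_ge0// mulrDl; apply: lerD.
  by apply: sqrt_ln_succ_le => //; rewrite powR_div_le// (le_trans ler01).
exact: sqrt_ln_succ_le.
Qed.

Lemma error_term_half_le B eps : 0 < B -> 0 < eps -> exists2 C : R, 0 <= C &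
  forall x t, 1 <= x -> x <= `|t| `^ B ->
  error_term 2^-1 x t <= C * (Num.sqrt x * `|t| `^ eps).
Proof.
move=> B0 eps0; have [C C0 sqrtlog_le] := sqrtlog_le_powR B0 eps0.
exists (C + 2) => [|x t x1 xt]; first exact: addr_ge0.
have t1 : 1 <= `|t| by apply: (powR_ge1_inv B0) => //; exact: le_trans xt.
have sqrt_le : Num.sqrt x <= Num.sqrt x * `|t| `^ eps.
  by rewrite ler_peMr ?sqrtr_ge0// powR_ge1// ltW.
have := sqrtlog_le x t x1 xt; rewrite /error_term.
have -> : 1 - 2^-1 = 2^-1 :> R by lra.
by rewrite powR12_sqrt ?(le_trans ler01)//; lra.
Qed.

Lemma LH_linear s A (C : R) :
  0 < A -> 0 < s 1%N -> finite_set (indices_le s 1) ->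
  (forall x t, 1 <= x ->
    Normc.normc (power_sum s x t - main_term A x t)
    <= C * error_term 2^-1 x t) ->
  LH s (fun x => A * x).
Proof.
move=> A0 s0 fin sum_le eps B eps0 B0; set a := s 1%N in s0 *.
have [C1 C10 error_le] := error_term_half_le B0 eps0.
pose N : R := (counting_fun s 1)%:R; have N0 : 0 <= N by [].
pose low := Num.sqrt a * a `^ (eps / B).
have low0 : 0 < low by rewrite mulr_gt0 ?sqrtr_gt0 ?powR_gt0.
pose C2 := (N + A + A * a) / low + `|C| * C1.
exists (C2 / Num.sqrt A) => t x ax xt; pose z := Num.sqrt x * `|t| `^ eps.
have x0 : 0 < x by exact: lt_le_trans ax.
have -> : C2 / Num.sqrt A * Num.sqrt (A * x) * `|t| `^ eps = C2 * z.
  by rewrite sqrtrM ?(ltW A0)// /z; field; rewrite gt_eqF// sqrtr_gt0.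
have low_z : low <= z.
  apply: ler_pM; rewrite ?sqrtr_ge0 ?powR_ge0 ?ler_wsqrtr//.
  by apply: powR_div_le => //; [exact: ltW | exact: le_trans xt].
have z0 : 0 < z by exact: lt_le_trans low_z.
have CC1z : 0 <= `|C| * C1 * z by rewrite !mulr_ge0 ?(ltW z0).
have sum_sub_le : Normc.normc (power_sum s x t - main_term A x t)
    <= N + A + `|C| * C1 * z.
  have [x1|/ltW x1] := leP 1 x; last first.
    have := normc_power_sum_main_term_bounded t (ltW A0) x0 x1 fin.
    by rewrite mulr1 => /le_trans; apply; rewrite lerDl.
  have err0 : 0 <= error_term 2^-1 x t.
    by rewrite !addr_ge0 ?sqrtlog_ge0 ?powR_ge0.
  apply: (le_trans (sum_le x t x1)).
  apply: (le_trans (ler_wpM2r err0 (ler_norm C))).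
  apply: (le_trans (ler_wpM2l (normr_ge0 C) (error_le x t x1 xt))).
  by rewrite mulrA lerDr addr_ge0// ltW.
rewrite Cintegral_cpowR// opprB addrCA; apply: (le_trans (le_normcD _ _)).
apply: (le_trans (lerD (normc_main_term_le t (ltW A0) s0) sum_sub_le)).
have const0 : 0 <= N + A + A * a by have := mulr_gt0 A0 s0; lra.
have : N + A + A * a <= (N + A + A * a) / low * z.
  by rewrite mulrAC ler_pdivlMr// ler_wpM2l.
rewrite /C2; lra.
Qed.

End PolynomialHeights.

Theorem theorem2p4 (R : realType) (d : measure_display) (T : measurableType d)
    (P : probability T R) (A K theta : R) (A0 : 0 < A) (K0 : 0 < K)
    (theta0 : 0 < theta) (theta1 : theta < 1) (n : nat -> {RV P >-> R})
    (n_unif : forall (j : nat) (j0 : (0 < j)%N),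
      uniformly_selected (n j) (sel_lt theta A0 K0 j0))
    (n_indep : mutually_independent [set j : nat | (0 < j)%N] n) :
  [/\ exists C : R, forall (w : T) (x : R), 1 <= x ->
        finite_set (indices_le (fun j => n j w) x) /\
        `|(counting_fun (fun j => n j w) x)%:R - A * x| <= C * x `^ theta,
      {ae P, forall w : T, exists C : R, forall x t : R, 1 <= x ->
        Normc.normc (power_sum (fun j => n j w) x t
          - A%:C * cpowR x (1 -i* t) / (1 -i* t))
        <= C * (Num.sqrt x * (Num.sqrt (ln (x + 1)) + Num.sqrt (ln (`|t| + 1)))
                + x `^ theta + x `^ (1 - theta))} &
      theta = 2^-1 ->
        {ae P, forall w : T, LH (fun j => n j w) (fun x => A * x)}].
Proof.
have windows := in_windows_selected n_unif.
have [C counting] := counting_fun_in_windows A0 K0 theta0 theta1.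
have power_sums : {ae P, forall w, exists C : R, forall x t, 1 <= x ->
    Normc.normc (power_sum (fun j => n j w) x t - main_term A x t)
    <= C * error_term theta x t}.
  have ae_sum := ae_fsum_osc_dist_le theta0 theta1 n_unif n_indep.
  apply: filterS2 (ae_sum 0) (ae_sum (pi / 2)) => w [C1 _ re_le] [C2 _ im_le].
  exists (C1 + C2) => x t x1; have [fin _] := counting _ x (windows w) x1.
  rewrite mulrDl; apply: normc_power_sum_main_term_le => //.
  + exact: lt_le_trans x1.
  + exact: re_le.
  + exact: im_le.
split=> [||theta_half].
- by exists C => w x; exact: counting.
- exact: power_sums.
- apply: filterS power_sums => w [C' sum_le].
  have [fin _] := counting _ 1 (windows w) (lexx _).
  apply: (LH_linear (C := C') A0 (in_windows_gt0 (windows w) (ltn0Sn 0)) fin).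
  by rewrite -theta_half.
Qed.
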